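(* Let $\mathbf V$ be a pseudovariety of semigroups that is not locally trivial. If $\mathbf V$ is $\kappa$-reducible, then the semidirect product $\mathbf V*\mathbf D$ is $\kappa$-reducible.
   Context: A pseudovariety of semigroups is a class of finite semigroups closed under taking subsemigroups, homomorphic images and finite direct products. It is locally trivial if, for every semigroup $T$ in it and every idempotent $e\in T$, the subsemigroup $eTe$ is trivial. $\mathbf D$ is the pseudovariety of all finite semigroups whose idempotents are right zeros (i.e. $se=e$ for every element $s$ and every idempotent $e$). $\mathbf V*\mathbf W$ denotes the semidirect product of pseudovarieties, i.e. the pseudovariety generated by all semidirect products $T*R$ with $T\in\mathbf V$ and $R\in\mathbf W$. $\mathbf S$ is the pseudovariety of all finite semigroups. For a finite non-empty alphabet $A$, $\overline{\Omega}_A\mathbf S$ is the free profinite semigroup on $A$; its elements are called pseudowords. A pseudovariety $\mathbf W$ satisfies a pseudoidentity $\pi=\rho$ (with $\pi,\rho\in\overline{\Omega}_A\mathbf S$), written $\mathbf W\models\pi=\rho$, if $\psi\pi=\psi\rho$ for every continuous homomorphism $\psi:\overline{\Omega}_A\mathbf S\to T$ with $T\in\mathbf W$. The canonical signature $\kappa=\{ab,a^{\omega-1}\}$ consists of multiplication and the $(\omega-1)$-power, where $a^{\omega-1}=\lim_n a^{n!-1}$. Elements of the $\kappa$-subalgebra $\Omega^\kappa_A\mathbf S$ of $\overline{\Omega}_A\mathbf S$ generated by $A$ (the smallest subset containing $A$ and closed under both operations) are called $\kappa$-words. To a finite directed multigraph $\Gamma=V(\Gamma)\uplus E(\Gamma)$,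 in which each edge $\mathsf e$ goes from the vertex $\alpha\mathsf e$ to the vertex $\omega\mathsf e$, associate the system $\Sigma_\Gamma$ of all equations $(\alpha\mathsf e)\,\mathsf e=\omega\mathsf e$ with $\mathsf e\in E(\Gamma)$. Let $S$ be a finite $A$-generated semigroup, let $\delta:\overline{\Omega}_A\mathbf S\to S$ be the continuous homomorphism respecting the choice of generators (extended by $\delta 1=1$ to $(\overline{\Omega}_A\mathbf S)^1\to S^1$), and let $\varphi:\Gamma\to S^1$ be a map with $\varphi E(\Gamma)\subseteq S$. A map $\eta:\Gamma\to(\overline{\Omega}_A\mathbf S)^1$ is a $\mathbf W$-solution of $\Sigma_\Gamma$ with respect to $(\varphi,\delta)$ if $\delta\eta=\varphi$ and $\mathbf W\models(\eta\alpha\mathsf e)(\eta\mathsf e)=\eta\omega\mathsf e$ for all $\mathsf e\in E(\Gamma)$. It is a $(\mathbf W,\kappa)$-solution if moreover $\eta\Gamma\subseteq(\Omega^\kappa_A\mathbf S)^1$. $\mathbf W$ is $\kappa$-reducible if, for every finite directed multigraph $\Gamma$, every finite non-empty alphabet $A$, every finite $A$-generated semigroup $S$ and every pair $(\varphi,\delta)$ consisting of a map $\varphi:\Gamma\to S^1$ with $\varphi E(\Gamma)\subseteq S$ and the continuous homomorphism $\delta:\overline{\Omega}_A\mathbf S\to S$ respecting the choice of generators (extended by $\delta 1=1$), the existence of a $\mathbf W$-solution of $\Sigma_\Gamma$ with respect to $(\varphi,\delta)$ implies the existence of a $(\mathbf W,\kappa)$-solution of $\Sigma_\Gamma$ with respect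 to the same pair $(\varphi,\delta)$. *)

(* Defs.v *)
From HB Require Import structures.
From mathcomp Require Import all_boot all_classical topology.

Set Implicit Arguments.
Unset Strict Implicit.
Unset Printing Implicit Defensive.

Local Open Scope classical_set_scope.
Local Open Scope group_scope.

(* The empty semigroup is not excluded.  It belongs to every pseudovariety
   below, and it satisfies every pseudoidentity because alphabets are
   non-empty. *)
#[short(type="finSemigroupType")]
HB.structure Definition FinSemigroup := {G of Semigroup G & Finite G}.

HB.instance Definition _ (S T : finSemigroupType) := Semigroup.on (S * T)%type.

Definition unit_mul (x y : unit) : unit := tt.

Fact unit_mulA : associative unit_mul. Proof. by []. Qed.

HB.instance Definition _ := isSemigroup.Build unit unit_mulA.

Definition is_identity (S : magmaType) (e : S) : Prop :=
  forall x : S, e * x = x /\ x * e = x.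

Definition idempotent_elt (S : magmaType) (e : S) : Prop := e * e = e.

(* S^1 is S itself if S has an identity, and S with a new identity adjoined
   otherwise.  Its elements are represented in [option S], [Some s] standing
   for s and [one1 S] for the identity: the latter is [None] exactly when S has
   no identity.  If S has an identity, then [None] does not represent any
   element of S^1. *)
Definition one1 (S : finSemigroupType) : option S :=
  [pick e : S | [forall x : S, (e * x == x) && (x * e == x)]].

(* The extension F^1 -> S^1, 1 |-> 1, of f : F -> S, for F without identity,
   so that F^1 is the whole of [option F] with identity [None]. *)
Definition ext1 (F : Type) (S : finSemigroupType) (f : F -> S)
    (x : option F) : option S :=
  if x is Some u then Some (f u) else one1 S.

Definition mul1 (F : magmaType) (x y : option F) : option F :=
  match x, y with
  | Some u, Some v => Some (u * v)
  | Some _, None => x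
  | None, _ => y
  end.

Definition semigroup_class := finSemigroupType -> Prop.

(* Finite direct products are generated by the empty and the binary ones. *)
Definition pseudovariety (V : semigroup_class) : Prop :=
  [/\ (forall (S T : finSemigroupType) (f : {multiplicative S -> T}),
         injective f -> V T -> V S),
      (forall (S T : finSemigroupType) (f : {multiplicative S -> T}),
         (forall t, exists s, f s = t) -> V S -> V T),
      V unit
    & forall S T : finSemigroupType, V S -> V T -> V (S * T)%type].

Definition locally_trivial (V : semigroup_class) : Prop :=
  forall T : finSemigroupType, V T ->
  forall e : T, idempotent_elt e -> forall x y : T, e * x * e = e * y * e.

Definition D_class : semigroup_class := fun T =>
  forall e : T, idempotent_elt e -> forall s : T, s * e = e.

(* Unitary left actions of R^1 on T by endomorphisms of T; the identity of R^1
   acts trivially, which is a condition only if R has an identity. *)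
Record left_action (T R : finSemigroupType) := LeftAction {
  act :> R -> T -> T;
  actMl : forall (r r' : R) (t : T), act (r * r') t = act r (act r' t);
  actMr : forall (r : R) (t t' : T), act r (t * t') = act r t * act r t';
  act_id : forall r : R, is_identity r -> forall t : T, act r t = t }.

Definition semidirect (T R : finSemigroupType) (a : left_action T R) : Type :=
  (T * R)%type.

Section Semidirect.
Variables (T R : finSemigroupType) (a : left_action T R).

HB.instance Definition _ := Finite.on (semidirect a).

Definition semidirect_mul (x y : semidirect a) : semidirect a :=
  (x.1 * a x.2 y.1, x.2 * y.2).

Fact semidirect_mulA : associative semidirect_mul.
Proof.
by move=> x y z; congr (_, _); rewrite ?actMl ?actMr /= ?actMl mulgA.
Qed.

HB.instance Definition _ := isSemigroup.Build (semidirect a) semidirect_mulA.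

End Semidirect.

(* V * W, the pseudovariety generated by the semidirect products T * R with
   T in V and R in W. *)
Definition semidirect_class (V W : semigroup_class) : semigroup_class :=
  fun S => forall U : semigroup_class, pseudovariety U ->
    (forall (T R : finSemigroupType) (a : left_action T R),
       V T -> W R -> U (semidirect a)) ->
    U S.

Record genSemigroup (A : finType) := GenSemigroup {
  gs_sort :> finSemigroupType;
  gen : A -> gs_sort;
  gs_generated : forall B : {set gs_sort},
    (forall x, gen x \in B) -> mulg_closed B -> forall s, s \in B }.

(* The free profinite semigroup on A is the inverse limit of all finite
   A-generated semigroups, with respect to the homomorphisms that respect the
   choice of generators, as a subspace of the product of discrete spaces. *)
Definition pseudoword_set (A : finType) :
    set (prod_topology (fun S : genSemigroup A => discrete_topology S)) :=
  [set u | forall (S T : genSemigroup A) (h : {multiplicative S -> T}),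
     (forall x, h (gen S x) = gen T x) -> h (u S) = u T].

Definition pseudoword (A : finType) : Type := set_type (@pseudoword_set A).

HB.instance Definition _ (A : finType) :=
  Topological.on (pseudoword A).

Section Pseudowords.
Variable A : finType.

Definition pw_fun (u : pseudoword A) (S : genSemigroup A) : S := set_val u S.

Fact pw_mul_subproof (u v : pseudoword A) :
  (fun S : genSemigroup A => pw_fun u S * pw_fun v S : discrete_topology S)
    \in @pseudoword_set A.
Proof.
rewrite inE => S T h hgen; rewrite gmulfM.
by have /set_mem/(_ S T h hgen) := valP u;
   have /set_mem/(_ S T h hgen) := valP v; rewrite /pw_fun => -> ->.
Qed.

Definition pw_mul (u v : pseudoword A) : pseudoword A :=
  @exist _ (fun f => f \in @pseudoword_set A) _ (pw_mul_subproof u v).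

Fact pw_mulA : associative pw_mul.
Proof.
move=> u v w; apply/val_inj/functional_extensionality_dep => S.
exact: (@mulgA S).
Qed.

HB.instance Definition _ := isSemigroup.Build (pseudoword A) pw_mulA.

Fact letter_subproof (x : A) :
  (fun S : genSemigroup A => gen S x : discrete_topology S)
    \in @pseudoword_set A.
Proof. by rewrite inE => S T h; apply. Qed.

Definition letter (x : A) : pseudoword A :=
  @exist _ (fun f => f \in @pseudoword_set A) _ (letter_subproof x).

(* [iterop k *%g u u] is the k-th power of u for k > 0; for the exponent
   n! - 1 this leaves out only n = 0 and n = 1, irrelevant to the limit. *)
Inductive kappa_word : pseudoword A -> Prop :=
| kappa_letter x : kappa_word (letter x)
| kappa_mul u v : kappa_word u -> kappa_word v -> kappa_word (u * v)
| kappa_omega1 u w :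
    kappa_word u ->
    (fun n : nat => iterop (n`!).-1 *%g u u) @ \oo --> w ->
    kappa_word w.

Definition continuous_hom (T : finSemigroupType)
    (f : {multiplicative pseudoword A -> T}) : Prop :=
  continuous (f : pseudoword A -> discrete_topology T).

(* Pseudoidentities between elements of the monoid of pseudowords with 1; on
   pseudowords proper this is the usual satisfaction relation. *)
Definition satisfies (W : semigroup_class) (u v : option (pseudoword A)) :=
  forall T : finSemigroupType, W T ->
  forall psi : {multiplicative pseudoword A -> T}, continuous_hom psi ->
  ext1 psi u = ext1 psi v.

End Pseudowords.

Record multigraph := Multigraph {
  vertex : finType;
  edge : finType;
  source : edge -> vertex;
  target : edge -> vertex }.

Section Solutions.
Variables (W : semigroup_class) (G : multigraph) (A : finType).
Variables (S : finSemigroupType) (phi : vertex G + edge G -> option S).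
Variable delta : pseudoword A -> S.
Implicit Types eta : vertex G + edge G -> option (pseudoword A).

Definition solution eta : Prop :=
  (forall z, ext1 delta (eta z) = phi z) /\
  (forall e : edge G,
     satisfies W (mul1 (eta (inl (source e))) (eta (inr e)))
                 (eta (inl (target e)))).

Definition kappa_solution eta : Prop :=
  solution eta /\ forall z u, eta z = Some u -> kappa_word u.

End Solutions.

Definition kappa_reducible (W : semigroup_class) : Prop :=
  forall (G : multigraph) (A : finType) (S : genSemigroup A)
    (phi : vertex G + edge G -> option S)
    (delta : {multiplicative pseudoword A -> S}),
  (0 < #|A|)%N ->
  (forall e : edge G, exists s : S, phi (inr e) = Some s) ->
  continuous_hom delta ->
  (forall x : A, delta (letter x) = gen S x) ->
  (exists eta, solution W phi delta eta) ->
  exists eta, kappa_solution W phi delta eta.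

(* Main.v *)
(* Let Q be the set of words of length at most K over A (windows).  Reading a
   pseudoword u from a window q and recording each letter together with the
   window preceding it gives a pseudoword [Phi q u] over Q * A.  The nonempty
   windows form a semigroup in D acting on powers of T in V, so an equation
   xy = z over V * D becomes [Phi 1 x * Phi q y = Phi 1 z] over V, where q is
   the window at the end of x.  As V is kappa-reducible, there are kappa-words
   solving the same equations over V which still label paths of windows with
   the same end points and have the same value in S.  To return to A, substitute
   for (q, a) the letter a, followed by f^omega if an insertion rule selects the
   word f at the window qa.  This yields a solution over V * D if inserting
   powers (i) does not change values in S, neither for vertices, read from the
   empty window, nor for edges, read from the window of their source; and
   (ii) gives words whose value in any semigroup R of D depends only on their
   last K letters.  Indeed, by (ii) the T-component of a value in T * R is the
   value in T of a word over Q * A.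

   The insertion rule: a word w is a candidate if it ends with a short word xf
   such that xf and x have the same value in S; every long enough factor
   contains candidates.  Condition (i) for edges forbids the finitely many
   windows occurring shortly after the beginning of an edge.  If all candidates
   in a long factor are forbidden, then one forbidden window occurs twice in it,
   so that it is periodic, of a period dividing a fixed P.  In a P-periodic run
   the power of its period is inserted exactly once, when the run reaches a
   length m that does not occur shortly after the beginning of an edge; later
   letters of the run rotate the period, since (cs)^omega c = c (sc)^omega. *)

From HB Require Import structures.
From mathcomp Require Import all_boot all_classical topology.
From mathcomp Require Import zify.
Require Import Defs.

Set Implicit Arguments.
Unset Strict Implicit.
Unset Printing Implicit Defensive.

Local Open Scope classical_set_scope.
Local Open Scope group_scope.

(** * Values of words and omega-powers *)

Section Mul1.
Variable T : semigroupType.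

Lemma mul1A : associative (@mul1 T).
Proof. by move=> [x|] [y|] [z|] //=; rewrite mulgA. Qed.

Lemma mul1N (x : option T) : mul1 x None = x.
Proof. by case: x. Qed.

End Mul1.

Arguments mul1 : simpl never.

Lemma omap_mul1 (S T : magmaType) (f : {multiplicative S -> T}) (x y : option S) :
  omap f (mul1 x y) = mul1 (omap f x) (omap f y).
Proof. by case: x y => [x|] [y|] //=; rewrite /mul1 /= gmulfM. Qed.

Section WordValue.
Variables (A : Type) (T : semigroupType) (f : A -> T).

Definition wval (w : seq A) : option T :=
  foldr (fun a => mul1 (Some (f a))) None w.

Lemma wval_cat u v : wval (u ++ v) = mul1 (wval u) (wval v).
Proof. by elim: u => [|a u IH] //=; rewrite IH mul1A. Qed.

Lemma wval_rcons u a : wval (rcons u a) = mul1 (wval u) (Some (f a)).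
Proof. by rewrite -cats1 wval_cat. Qed.

Lemma wvalP w : w <> [::] -> exists x, wval w = Some x.
Proof.
case: w => //= a w _; case: (wval w) => [x|] /=; first by exists (f a * x).
by exists (f a).
Qed.

Lemma wval_neq0 w x : wval w = Some x -> w <> [::].
Proof. by case: w. Qed.

End WordValue.

Lemma omap_wval A (S T : semigroupType) (h : {multiplicative S -> T}) (f : A -> S) w :
  omap h (wval f w) = wval (h \o f) w.
Proof. by elim: w => //= a w <-; rewrite omap_mul1. Qed.

Lemma eq_wval A (T : semigroupType) (f g : A -> T) : f =1 g -> wval f =1 wval g.
Proof. by move=> fg; elim=> //= a w ->; rewrite fg. Qed.

Section Pair.
Variables S T : finSemigroupType.

Fact fst_multM : {morph (fst : S * T -> S) : x y / x * y}. Proof. by []. Qed.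
Fact snd_multM : {morph (snd : S * T -> T) : x y / x * y}. Proof. by []. Qed.

HB.instance Definition _ := isMultiplicative.Build (S * T)%type S fst fst_multM.
HB.instance Definition _ := isMultiplicative.Build (S * T)%type T snd snd_multM.

End Pair.

Section Powers.
Variable T : semigroupType.
Implicit Types (x y z : T).

(** The default of [iterop] makes this x at n = 0, hence the positivity hypotheses below. *)
Definition xpow x n := iterop n *%g x x.

Lemma xpowS x n : (0 < n)%N -> xpow x n.+1 = x * xpow x n.
Proof. by case: n. Qed.

Lemma xpowD x m n : (0 < m)%N -> (0 < n)%N -> xpow x (m + n) = xpow x m * xpow x n.
Proof.
case: m => // m _ n0; elim: m => [|m IH]; first by rewrite add1n xpowS.
have mn : (0 < m.+1 + n)%N by rewrite addSn.
by rewrite addSn (xpowS x mn) IH (xpowS x (ltn0Sn m)) mulgA.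
Qed.

Lemma xpow_comm x n : (0 < n)%N -> xpow x n * x = x * xpow x n.
Proof. by move=> n0; rewrite -[in LHS](xpowD x n0 (ltn0Sn 0)) addn1 xpowS. Qed.

Lemma xpow_shift x y n : (0 < n)%N -> xpow (x * y) n * x = x * xpow (y * x) n.
Proof.
case: n => // n _; elim: n => [|n IH]; first exact/esym/mulgA.
by rewrite !(xpowS _ (ltn0Sn n)) -!mulgA IH !mulgA.
Qed.

Lemma xpow_absorb x y n : (0 < n)%N -> y * x = y -> y * xpow x n = y.
Proof.
by case: n => // n _ yx; elim: n => [//|n IH]; rewrite xpowS // mulgA yx.
Qed.

End Powers.

Lemma xpow_nat (S T : semigroupType) (h : {multiplicative S -> T}) x n :
  h (xpow x n) = xpow (h x) n.
Proof.
case: n => // n; elim: n => [//|n IH].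
by rewrite !(xpowS _ (ltn0Sn n)) gmulfM IH.
Qed.

Section FinitePowers.
Variable T : finSemigroupType.
Implicit Types (x y z : T).

Lemma xpow_cycle x : exists i p : nat,
  [/\ (0 < i <= #|T|)%N, (0 < p <= #|T|)%N & xpow x (i + p) = xpow x i].
Proof.
pose F (i : 'I_#|T|.+1) := xpow x i.+1.
have /injectivePn [i [j ij Fij]] : ~~ injectiveb F.
  apply/negP => /injectiveP /leq_card.
  by rewrite card_ord ltnn.
wlog lt_ij : i j ij Fij / (i < j)%N => [W|].
  have := ij; rewrite -val_eqE neq_ltn => /orP[]; first exact: (W i j).
  by apply: (W j i); rewrite // eq_sym.
exists i.+1, (j - i)%N; split.
- by rewrite (leq_trans lt_ij) // -ltnS.
- by rewrite subn_gt0 lt_ij (leq_trans (leq_subr _ _)) // -ltnS.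
- by rewrite addSn subnKC ?(ltnW lt_ij).
Qed.

(** Index and period of x are both at most |T|, so the period divides |T|!. *)
Lemma xpow_period x n d : (#|T| <= n)%N -> ((#|T|)`! %| d)%N -> xpow x (n + d) = xpow x n.
Proof.
have [i [p [/andP[i0 iT] /andP[p0 pT] xip]]] := xpow_cycle x.
move=> Tn Td; have /dvdnP[c ->] : (p %| d)%N.
  by apply: dvdn_trans Td; apply: dvdn_fact; rewrite p0.
have iTn : (i <= n)%N := leq_trans iT Tn.
elim: c => [|c IH]; first by rewrite addn0.
rewrite mulSn addnCA addnC; move: IH; set m := (n + c * p)%N.
have im : (i <= m)%N by rewrite (leq_trans iTn) ?leq_addr.
move: im; rewrite leq_eqVlt => /orP[/eqP <- <- //|im <-].
have m0 : (0 < m - i)%N by rewrite subn_gt0.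
rewrite -(subnK (ltnW im)) -addnA [LHS]xpowD ?addn_gt0 ?i0 // xip.
by rewrite [RHS]xpowD.
Qed.

Lemma fact_sub m n : (m <= n)%N -> (m`! %| n`!.-1 - m`!.-1)%N.
Proof.
move=> mn; rewrite -subSS !prednK ?fact_gt0 //.
by apply: dvdn_sub; rewrite // -(bin_fact mn) dvdn_mull // dvdn_mulr.
Qed.

(** The limit of x^(n!-1). From n = |T| + 2 on, the exponents exceed the index of x and differ by
    multiples of |T|!, so the sequence is constant. *)
Definition om1 x := xpow x (#|T|.+2)`!.-1.
Definition om x := om1 x * x.

Lemma ltn_fact_pred n : (n < n.+2`!.-1)%N.
Proof.
rewrite factS -ltnS prednK ?muln_gt0 ?fact_gt0 //.
by rewrite (leq_trans (leq_pmulr n.+2 (fact_gt0 n.+1))).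
Qed.

Lemma om1_eventually x n : (#|T|.+2 <= n)%N -> xpow x n`!.-1 = om1 x.
Proof.
move=> Tn; have fm : ((#|T|.+2)`!.-1 <= n`!.-1)%N.
  by rewrite -!subn1 leq_sub2r // leq_fact.
rewrite -(subnKC fm) /om1 xpow_period ?(ltnW (ltn_fact_pred _)) //.
by rewrite (dvdn_trans _ (fact_sub Tn)) // !factS !dvdn_mull.
Qed.

Lemma omE x : om x = xpow x ((#|T|.+2)`!).
Proof.
rewrite /om /om1 -[x in _ * x]/(xpow x 1) -xpowD ?addn1 ?prednK ?fact_gt0 //.
by rewrite (leq_ltn_trans _ (ltn_fact_pred _)).
Qed.

Lemma om_xpow x n : (#|T| <= n)%N -> xpow x n * om x = xpow x n.
Proof.
move=> Tn; rewrite omE -xpowD ?fact_gt0 //; last first.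
  by rewrite (leq_trans _ Tn) //; apply/card_gt0P; exists x.
by rewrite xpow_period // !factS !dvdn_mull.
Qed.

Lemma om_idem x : om x * om x = om x.
Proof.
rewrite {1 3}omE om_xpow //.
exact: leq_trans (ltnW (ltn_fact_pred _)) (leq_pred _).
Qed.

Lemma om_shift x y : om (x * y) * x = x * om (y * x).
Proof. by rewrite !omE xpow_shift ?fact_gt0. Qed.

Lemma om_absorb x y : y * x = y -> y * om x = y.
Proof. by rewrite omE; apply: xpow_absorb; rewrite fact_gt0. Qed.

End FinitePowers.

Section OmegaNat.
Variables (S T : finSemigroupType) (h : {multiplicative S -> T}).

(** The exponents used for S and T differ; a larger n!-1 gives the same powers in both. *)
Lemma om1_nat x : h (om1 x) = om1 (h x).
Proof.
pose n := maxn #|S|.+2 #|T|.+2.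
rewrite -(@om1_eventually S x n) ?leq_maxl //.
by rewrite -(@om1_eventually T _ n) ?leq_maxr // xpow_nat.
Qed.

End OmegaNat.

(** * Pseudowords as implicit operations *)

Section Generated.
Variables (A : finType) (T : finSemigroupType) (f : A -> T).

Definition in_gen : pred T := fun x => `[< exists w, wval f w = Some x >].

(** Makes an arbitrary f : A -> T, which need not generate T, an index of the inverse limit. *)
Definition gen_sub : Type := {x : T | in_gen x}.

HB.instance Definition _ := [isSub of gen_sub for sval].
HB.instance Definition _ := [Finite of gen_sub by <:].

Fact gen_sub_mul_subproof (x y : gen_sub) : in_gen (val x * val y).
Proof.
case: x y => [x /= /asboolP[u ux]] [y /= /asboolP[v vy]].
by apply/asboolP; exists (u ++ v); rewrite wval_cat ux vy.
Qed.

Definition gen_sub_mul (x y : gen_sub) : gen_sub := Sub _ (gen_sub_mul_subproof x y).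

Fact gen_sub_mulA : associative gen_sub_mul.
Proof. by move=> x y z; apply: val_inj; rewrite /= mulgA. Qed.

HB.instance Definition _ := isSemigroup.Build gen_sub gen_sub_mulA.

Definition gen_val (x : gen_sub) : T := val x.

Fact gen_valM : {morph gen_val : x y / x * y}.
Proof. by []. Qed.

HB.instance Definition _ := isMultiplicative.Build gen_sub T gen_val gen_valM.

Fact gen_sub_gen_subproof a : in_gen (f a).
Proof. by apply/asboolP; exists [:: a]. Qed.

Definition gen_sub_gen a : gen_sub := Sub _ (gen_sub_gen_subproof a).

Fact gen_sub_generated (B : {set gen_sub}) :
  (forall a, gen_sub_gen a \in B) -> mulg_closed B -> forall s, s \in B.
Proof.
move=> genB mulB s; have /asboolP[w] := valP s.
elim: w s => [//|a w IH] s /=; case E: (wval f w) => [x|] /= -[].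
  have gx : in_gen x by apply/asboolP; exists w.
  by move=> xs; rewrite (_ : s = gen_sub_gen a * (Sub x gx : gen_sub)) ?mulB ?genB ?IH //; apply: val_inj.
by move=> fs; rewrite (_ : s = gen_sub_gen a) ?genB //; apply: val_inj.
Qed.

Definition gen_semigroup : genSemigroup A := GenSemigroup gen_sub_generated.

End Generated.

Section Evaluation.
Variable A : finType.
Implicit Types u v : pseudoword A.

(** The continuous homomorphism extending f, read off the coordinate at the subsemigroup that f
    generates. *)
Definition ev (T : finSemigroupType) (f : A -> T) u : T :=
  val (pw_fun u (gen_semigroup f) : gen_sub f).

Lemma pw_fun_nat u (S T : genSemigroup A) (h : {multiplicative S -> T}) :
  (forall x, h (gen S x) = gen T x) -> h (pw_fun u S) = pw_fun u T.
Proof. by have /set_mem := valP u; apply. Qed.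

Lemma ev_gen u (S : genSemigroup A) : ev (gen S) u = pw_fun u S.
Proof.
exact: (@pw_fun_nat u (gen_semigroup (gen S)) S (@gen_val A S (gen S))).
Qed.

Section Nat.
Variables (S T : finSemigroupType) (h : {multiplicative S -> T}) (f : A -> S) (g : A -> T).
Hypothesis hf : forall a, h (f a) = g a.

Fact gen_map_subproof (x : gen_sub f) : in_gen g (h (val x)).
Proof.
case: x => x /= /asboolP[w wx]; apply/asboolP; exists w.
by rewrite -(eq_wval hf) -omap_wval wx.
Qed.

Definition gen_map (x : gen_sub f) : gen_sub g := Sub _ (gen_map_subproof x).

Fact gen_map_multM : {morph gen_map : x y / x * y}.
Proof. by move=> x y; apply: val_inj; rewrite /= gmulfM. Qed.

HB.instance Definition _ := isMultiplicative.Build _ _ gen_map gen_map_multM.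

Lemma ev_nat u : h (ev f u) = ev g u.
Proof.
rewrite /ev -(@pw_fun_nat u (gen_semigroup f) (gen_semigroup g) gen_map) //.
by move=> a; apply: val_inj; rewrite /= hf.
Qed.

End Nat.

Lemma eq_ev (T : finSemigroupType) (f g : A -> T) u : f =1 g -> ev f u = ev g u.
Proof. by move=> /funext ->. Qed.

Section EvTheory.
Variables (T : finSemigroupType) (f : A -> T).

Lemma evM u v : ev f (u * v) = ev f u * ev f v. Proof. by []. Qed.

HB.instance Definition _ := isMultiplicative.Build (pseudoword A) T (ev f) evM.

Lemma ev_word u : exists w, wval f w = Some (ev f u).
Proof. by have /asboolP := valP (pw_fun u (gen_semigroup f) : gen_sub f). Qed.

End EvTheory.

Lemma ev_pair (S T : finSemigroupType) (f : A -> S) (g : A -> T) u :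
  ev (fun a => (f a, g a)) u = (ev f u, ev g u).
Proof.
rewrite [LHS]surjective_pairing; congr (_, _).
  exact: (@ev_nat _ _ (fst : (S * T)%type -> S)).
exact: (@ev_nat _ _ (snd : (S * T)%type -> T)).
Qed.

Lemma wval_pair (S T : finSemigroupType) (f : A -> S) (g : A -> T) w s t :
  wval (fun a => (f a, g a)) w = Some (s, t) ->
  wval f w = Some s /\ wval g w = Some t.
Proof.
move=> wst; split.
  by rewrite -[RHS](congr1 (omap fst) wst) (omap_wval (fst : (S * T)%type -> S)).
by rewrite -[RHS](congr1 (omap snd) wst) (omap_wval (snd : (S * T)%type -> T)).
Qed.

(** The word is taken for the product of S and T, so it serves both. Claims about values of
    pseudowords reduce to words in this way. *)
Lemma ev_word2 (S T : finSemigroupType) (f : A -> S) (g : A -> T) u :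
  exists w, wval f w = Some (ev f u) /\ wval g w = Some (ev g u).
Proof.
have [w] := ev_word (fun a => (f a, g a)) u; rewrite ev_pair => /wval_pair.
by exists w.
Qed.

Lemma pw_ext u v : (forall S, pw_fun u S = pw_fun v S) -> u = v.
Proof. by move=> uv; apply/val_inj/functional_extensionality_dep. Qed.

Section ImplicitOperation.
Variable o : forall T : finSemigroupType, (A -> T) -> T.
Hypothesis o_nat : forall (S T : finSemigroupType) (h : {multiplicative S -> T}) f g,
  (forall a, h (f a) = g a) -> h (o f) = o g.

Fact pw_of_subproof :
  (fun S : genSemigroup A => o (gen S) : discrete_topology S) \in @pseudoword_set A.
Proof. by rewrite inE => S T h /o_nat. Qed.

(** A natural family of operations is a compatible family of coordinates. Substitution, the
    (omega-1)-power and [Phi] are thus constructed from their values. *)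
Definition pw_of : pseudoword A :=
  @exist _ (fun f => f \in @pseudoword_set A) _ pw_of_subproof.

Lemma ev_pw_of (T : finSemigroupType) (f : A -> T) : ev f pw_of = o f.
Proof. exact: (@o_nat _ _ (@gen_val A T f)). Qed.

End ImplicitOperation.

End Evaluation.

Section Substitution.
Variables (A B : finType) (th : B -> pseudoword A).

Fact subst_nat (S T : finSemigroupType) (h : {multiplicative S -> T}) (u : pseudoword B) f g :
  (forall a, h (f a) = g a) ->
  h (ev (fun b => ev f (th b)) u) = ev (fun b => ev g (th b)) u.
Proof. by move=> hf; apply: ev_nat => b; apply: ev_nat. Qed.

Definition subst (u : pseudoword B) : pseudoword A :=
  pw_of (fun S T h f g => @subst_nat S T h u f g).

Lemma ev_subst (T : finSemigroupType) (f : A -> T) u :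
  ev f (subst u) = ev (fun b => ev f (th b)) u.
Proof. exact: ev_pw_of. Qed.

End Substitution.

Section OmegaPower.
Variable A : finType.
Implicit Types u v w : pseudoword A.

Fact pw_om1_nat u (S T : finSemigroupType) (h : {multiplicative S -> T}) f g :
  (forall a : A, h (f a) = g a) -> h (om1 (ev f u)) = om1 (ev g u).
Proof. by move=> hf; rewrite om1_nat (ev_nat hf). Qed.

Definition pw_om1 u : pseudoword A := pw_of (fun S T h f g => @pw_om1_nat u S T h f g).

Lemma ev_om1 (T : finSemigroupType) (f : A -> T) u : ev f (pw_om1 u) = om1 (ev f u).
Proof. exact: ev_pw_of. Qed.

End OmegaPower.

(** * Convergence, continuity and kappa-words *)

Section Topology.
Variable A : finType.
Implicit Types u v w : pseudoword A.

Lemma pw_fun_xpow u n (S : genSemigroup A) : pw_fun (xpow u n) S = xpow (pw_fun u S) n.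
Proof.
case: n => // n; elim: n => [//|n IH].
by rewrite !(xpowS _ (ltn0Sn n)) -IH.
Qed.

Lemma nbhs_pw u (S : genSemigroup A) : nbhs u [set v | pw_fun v S = pw_fun u S].
Proof.
pose PT := prod_topology (fun S : genSemigroup A => discrete_topology S).
have cv : nbhs (set_val u : PT) [set f : PT | f S = set_val u S].
  have /cvg_sup/(_ S) H : nbhs (set_val u : PT) --> (set_val u : PT) by apply: cvg_id.
  refine (H [set f : PT | f S = set_val u S] _).
  refine (@initial_continuous PT (discrete_topology S) (fun f : PT => f S) (set_val u) [set set_val u S] _).
  exact: (@discrete_set1 (discrete_topology S)).
exact: (@initial_continuous (pseudoword A) PT set_val u _ cv).
Qed.

(** A basic open set involves finitely many coordinates. They merge into one: those at S and T are
    determined by that at the subsemigroup generated in the product of S and T. *)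
Lemma nbhs_pw_gen u (B : set (pseudoword A)) : nbhs u B ->
  exists S : genSemigroup A, forall v, pw_fun v S = pw_fun u S -> B v.
Proof.
pose PT := prod_topology (fun S : genSemigroup A => discrete_topology S).
pose F : set_system PT := [set C | exists S : genSemigroup A,
  forall v : pseudoword A, pw_fun v S = pw_fun u S -> C (set_val v)].
have FF : Filter F.
  split.
  - exists (gen_semigroup (fun _ : A => (tt : unit))) => //.
  - move=> C D [S SC] [T TD]; exists (gen_semigroup (fun a => (gen S a, gen T a))) => v.
    pose g a := (gen S a, gen T a).
    move=> /(congr1 (@gen_val A (S * T)%type g)) vu.
    have {vu} : ev g v = ev g u := vu.
    by rewrite !ev_pair !ev_gen => -[vS vT]; split; [apply: SC|apply: TD].
  - by move=> C D CD [S SC]; exists S => v /SC /CD.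
have Fu : F --> (set_val u : PT).
  apply/cvg_sup => S C.
  rewrite nbhsE => -[D [[E _ <-] /= Eu] DC]; exists S => v vS; apply: DC => /=.
  by rewrite -[set_val v S]/(pw_fun v S) vS.
move=> [D [[C oC <-] /= Cu] CB].
have [S SC] : F C by apply: Fu; apply: open_nbhs_nbhs.
by exists S => v /SC /CB.
Qed.

Lemma pw_cvg (F : nat -> pseudoword A) u : F @ \oo --> u <->
  forall S : genSemigroup A, \forall n \near \oo, pw_fun (F n) S = pw_fun u S.
Proof.
split=> [Fu S|Fu B /nbhs_pw_gen[S SB]].
  by apply: (Fu [set v | pw_fun v S = pw_fun u S]); apply: nbhs_pw.
by apply: filterS (Fu S) => n /SB.
Qed.

Lemma kappa_om1 u : kappa_word u -> kappa_word (pw_om1 u).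
Proof.
move=> /kappa_omega1; apply; apply/pw_cvg => S.
exists (#|S|.+2)%N => // n /= Sn.
by rewrite -[iterop _ _ _ _]/(xpow u _) pw_fun_xpow om1_eventually // -!ev_gen ev_om1.
Qed.

Lemma cvg_om1 u w : (fun n : nat => iterop (n`!).-1 *%g u u) @ \oo --> w -> w = pw_om1 u.
Proof.
move=> /pw_cvg uw; apply: pw_ext => S; have [n _ nw] := uw S.
have /nw /= <- : (n <= maxn n #|S|.+2)%N by rewrite leq_maxl.
rewrite -[iterop _ _ _ _]/(xpow u _) pw_fun_xpow om1_eventually ?leq_maxr //.
by rewrite -!ev_gen ev_om1.
Qed.

Lemma ev_continuous (T : finSemigroupType) (f : A -> T) :
  continuous_hom (ev f : {multiplicative pseudoword A -> T}).
Proof.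
move=> u B; rewrite [X in X -> _]/nbhs /= => /principal_filterP Bu.
have := nbhs_pw u (gen_semigroup f); apply: filterS => v /= vu.
by rewrite /ev vu.
Qed.

Fixpoint letters (a : A) (w : seq A) : pseudoword A :=
  if w is b :: w' then letter a * letters b w' else letter a.

Lemma wval_letters (T : semigroupType) (h : {multiplicative pseudoword A -> T}) a (w : seq A) :
  wval (h \o @letter A) (a :: w) = Some (h (letters a w)).
Proof.
elim: w a => //= b w IH a; rewrite gmulfM.
by move: (IH b) => /= ->.
Qed.

(** Words are dense: some word agrees with u both where h is constant and under evaluation at the
    images of the letters. *)
Lemma continuous_homE (T : finSemigroupType) (h : {multiplicative pseudoword A -> T}) u :
  continuous_hom h -> h u = ev (h \o @letter A) u.
Proof.
move=> hc; have /nbhs_pw_gen [S Su] : nbhs u (h @^-1` [set h u]).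
  by apply: hc; apply: discrete_set1.
have [w []] := ev_word2 (gen S) (h \o @letter A) u; case: w => // a w wS wT.
have wu : pw_fun (letters a w) S = pw_fun u S.
  apply: Some_inj; rewrite -!ev_gen -wS -(wval_letters (ev (gen S))).
  by apply: eq_wval.
by rewrite -(Su _ wu); apply: Some_inj; rewrite -wT wval_letters.
Qed.

End Topology.

Lemma kappa_subst (A B : finType) (th : B -> pseudoword A) u :
  (forall b, kappa_word (th b)) -> kappa_word u -> kappa_word (subst th u).
Proof.
move=> kth; elim=> {u} [b|u v _ ku _ kv|u w _ ku /cvg_om1 ->].
- by rewrite (_ : subst th _ = th b) //; apply: pw_ext => S; rewrite -!ev_gen ev_subst.
- rewrite (_ : subst th _ = subst th u * subst th v); first exact: kappa_mul.
  by apply: pw_ext => S; rewrite -!ev_gen ev_subst !evM !ev_subst.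
rewrite (_ : subst th _ = pw_om1 (subst th u)); first exact: kappa_om1.
by apply: pw_ext => S; rewrite -!ev_gen ev_subst !ev_om1 ev_subst.
Qed.

Lemma satisfiesP (W : semigroup_class) (A : finType) (u v : option (pseudoword A)) :
  satisfies W u v <-> forall T : finSemigroupType, W T -> forall f : A -> T,
    ext1 (ev f) u = ext1 (ev f) v.
Proof.
split=> [uv T WT f|uv T WT h hc]; first exact/uv/ev_continuous.
have E z : ext1 h z = ext1 (ev (h \o @letter A)) z.
  by case: z => [z|] //=; rewrite (continuous_homE z hc).
by rewrite !E; apply: uv.
Qed.

(** * Inserting omega-powers in words *)

Section Suffixes.
Variable A : Type.
Implicit Types (u v w : seq A) (m n p i j : nat).

Definition lastn n w := drop (size w - n) w.

Lemma size_lastn n w : size (lastn n w) = minn n (size w).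
Proof. by rewrite size_drop; lia. Qed.

Lemma lastn_id n w : (size w <= n)%N -> lastn n w = w.
Proof. by rewrite -subn_eq0 /lastn => /eqP ->; rewrite drop0. Qed.

Lemma lastn_cat n u v : lastn n (u ++ v) = lastn (n - size v) u ++ lastn n v.
Proof.
rewrite /lastn size_cat drop_cat.
case: ltnP => h.
  by rewrite (_ : size v - n = 0)%N ?drop0; [congr (drop _ _ ++ _)|]; lia.
rewrite [drop (size u - (n - size v)) u]drop_oversize /=; last lia.
by congr drop; lia.
Qed.

Lemma lastn_cat_short n u v : (size v <= n)%N -> lastn n (u ++ v) = lastn (n - size v) u ++ v.
Proof. by move=> vn; rewrite lastn_cat (lastn_id vn). Qed.

Lemma lastn0 w : lastn 0 w = [::].
Proof. by rewrite /lastn subn0 drop_size. Qed.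

Lemma lastn_cat_long n u v : (n <= size v)%N -> lastn n (u ++ v) = lastn n v.
Proof. by rewrite lastn_cat -subn_eq0 => /eqP ->; rewrite lastn0. Qed.

Lemma lastn_lastn m n w : (m <= n)%N -> lastn m (lastn n w) = lastn m w.
Proof. by move=> mn; rewrite /lastn drop_drop size_drop; congr drop; lia. Qed.

Lemma lastn_cat_lastn m n u v : (m <= n)%N -> lastn m (lastn n u ++ v) = lastn m (u ++ v).
Proof. by move=> mn; rewrite !lastn_cat lastn_lastn //; lia. Qed.

Lemma lastn_cat_lastnr n u v : lastn n (u ++ lastn n v) = lastn n (u ++ v).
Proof. by rewrite !lastn_cat lastn_lastn // size_lastn; congr (lastn _ _ ++ _); lia. Qed.

Lemma lastn_split n w : w = take (size w - n) w ++ lastn n w.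
Proof. by rewrite cat_take_drop. Qed.

End Suffixes.

Section Periodic.
Variable A : eqType.
Implicit Types (u v w : seq A) (m n p i j : nat).

(** Holds for every word of length at most p, which is why [lrun] also requires a length. *)
Definition periodic p w := drop p w == take (size w - p) w.

Lemma periodicP p w : reflect
  (forall x i, (i + p < size w)%N -> nth x w i = nth x w (i + p)) (periodic p w).
Proof.
apply: (iffP eqP) => [E x i ip|E].
  by rewrite addnC -nth_drop E nth_take //; lia.
case: w E => [|x w'] //; move: (x :: w') => w E.
apply: (@eq_from_nth _ x) => [|i]; first by rewrite size_drop size_take_min; lia.
rewrite size_drop => ip; rewrite nth_drop nth_take; last lia.
by rewrite addnC -(E x) //; lia.
Qed.

Lemma periodic_lastn p n w : periodic p w -> periodic p (lastn n w).
Proof.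
move=> /periodicP E; apply/periodicP => x i; rewrite size_lastn => ip.
by rewrite !nth_drop (E x) ?addnA //; lia.
Qed.

Lemma periodic_take p n w : periodic p w -> periodic p (take n w).
Proof.
move=> /periodicP E; apply/periodicP => x i; rewrite size_take_min => ip.
by rewrite !nth_take 1?(E x) //; lia.
Qed.

Lemma periodic_dvd p q w : (p %| q)%N -> periodic p w -> periodic q w.
Proof.
move=> /dvdnP[c ->] /periodicP E; apply/periodicP => x i.
elim: c i => [|c IH] i; first by rewrite addn0.
rewrite mulSn => ip; rewrite IH; last lia; rewrite (E x); last lia; congr nth; lia.
Qed.

Lemma periodic_flatten p n w : size w = (n * p)%N -> periodic p w ->
  w = flatten (nseq n (lastn p w)).
Proof.
have H m v : size v = (m * p)%N -> periodic p v -> v = flatten (nseq m (take p v)).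
  elim: m v => [|m IH] v; first by rewrite mul0n => /size0nil.
  rewrite mulSn => sv pv; have sd : size (take (size v - p) v) = (m * p)%N.
    by rewrite size_take_min sv addKn (minn_idPl (leq_addl _ _)).
  rewrite -{1}(cat_take_drop p v) (eqP pv) /=; congr (_ ++ _).
  rewrite {1}(IH _ sd (periodic_take _ pv)).
  case: m sv {IH sd} => [//|m] sv; congr (flatten (nseq _ _)).
  by rewrite take_takel // sv addKn mulSn leq_addr.
move=> sw pw; rewrite {1}(H n w sw pw).
case: n sw => [//|n]; rewrite mulSn => sw.
congr (flatten (nseq _ _)).
have st : size (take p w) = p by rewrite size_take_min sw (minn_idPl (leq_addr _ _)).
rewrite [in RHS](H n.+1 w _ pw) -?mulSn // -addn1 nseqD flatten_cat /= cats0.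
by rewrite lastn_cat_long ?st // lastn_id ?st.
Qed.

End Periodic.

Lemma wval_flatten (A : Type) (T : semigroupType) (f : A -> T) n w x :
  wval f w = Some x -> wval f (flatten (nseq n.+1 w)) = Some (xpow x n.+1).
Proof.
move=> wx; elim: n => [|n IH]; first by rewrite /= cats0.
by rewrite xpowS // -[n.+2]add1n nseqD flatten_cat wval_cat IH /= cats0 wx.
Qed.

(** * Values of words with insertions *)

Section Image.
Variables (A : Type) (ins : seq A -> option (seq A)).

Definition om_opt (T : finSemigroupType) : option T -> option T := omap (@om T).

Section Def.
Variables (T : finSemigroupType) (f : A -> T).

(* The word h ends with the letter a whose value is taken. *)
Definition step_val (h : seq A) (a : A) : option T :=
  mul1 (Some (f a)) (om_opt (obind (wval f) (ins h))).

Fixpoint img (h v : seq A) : option T :=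
  if v is a :: v' then mul1 (step_val (rcons h a) a) (img (rcons h a) v') else None.

Lemma img_cat h u v : img h (u ++ v) = mul1 (img h u) (img (h ++ u) v).
Proof.
elim: u h => [|a u IH] h /=; first by rewrite cats0.
by rewrite IH mul1A cat_rcons.
Qed.

Lemma img_rcons h v a :
  img h (rcons v a) = mul1 (img h v) (step_val (h ++ rcons v a) a).
Proof. by rewrite -cats1 img_cat /= mul1N rcons_cat cats1. Qed.

Lemma img_local k h h' v : (forall w, ins (lastn k w) = ins w) ->
  lastn k h = lastn k h' -> img h v = img h' v.
Proof.
move=> insk; elim: v h h' => //= a v IH h h' hh'.
have E : lastn k (rcons h a) = lastn k (rcons h' a).
  by rewrite -!cats1 -(lastn_cat_lastn _ _ (leqnn k)) hh' lastn_cat_lastn.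
by rewrite (IH _ _ E) /step_val -insk E insk.
Qed.

(** Insertions are deleted from left to right, each absorbed by the part u of v read so far. *)
Lemma img_neutral h v :
  (forall u w g, v = u ++ w -> u <> [::] -> ins (h ++ u) = Some g ->
     mul1 (wval f u) (om_opt (wval f g)) = wval f u) ->
  img h v = wval f v.
Proof.
elim/last_ind: v => [//|v a IH] H; rewrite img_rcons IH.
  rewrite /step_val mul1A -wval_rcons.
  case E: (ins _) => [g|] /=; last by rewrite mul1N.
  by apply: (H _ [::]) => //; rewrite ?cats0 //; case: (v).
by move=> u w g vE u0; apply: (H _ (rcons w a)); rewrite // vE rcons_cat.
Qed.

End Def.

End Image.

Section Insertion.
Variables (A : eqType) (S : finSemigroupType) (d : A -> S).
Variables (N P m k : nat) (J : seq (seq A)).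
Implicit Types (u v w x f : seq A).

Definition lrun n w := (n <= size w)%N && periodic P (lastn n w).

Definition cand_rel w f := exists u x,
  [/\ w = u ++ x ++ f, x <> [::], f <> [::] & wval d (x ++ f) = wval d x].

(** The choice is made from the last N letters alone, so words that share them get the same f. *)
Definition cand w : option (seq A) :=
  if pselect (exists f, cand_rel (lastn N w) f) is left e then Some (sval (cid e)) else None.

(* J lists the words where an insertion could be visible in an edge. *)
Definition ins w : option (seq A) :=
  if lrun m w then (if lrun m.+1 w then None else Some (lastn P w))
  else if lastn k w \in map (lastn k) J then None else cand w.

Hypotheses (mk : (m < k)%N) (Nk : (N <= k)%N) (P0 : (0 < P)%N) (Pm : (P * #|S| <= m)%N).
Hypothesis (Pm' : (P <= m)%N).

Lemma candP w f : cand w = Some f -> cand_rel (lastn N w) f.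
Proof. by rewrite /cand; case: pselect => // e [<-]; case: (cid e). Qed.

Lemma cand_lastn n w : (N <= n)%N -> cand (lastn n w) = cand w.
Proof. by move=> Nn; rewrite /cand lastn_lastn. Qed.

Lemma lrun_lastn i n w : (i <= n)%N -> lrun i (lastn n w) = lrun i w.
Proof.
by move=> le_in; rewrite /lrun lastn_lastn // size_lastn leq_min le_in.
Qed.

Lemma lrun_le i j w : (i <= j)%N -> lrun j w -> lrun i w.
Proof.
move=> ij /andP[jw pw]; rewrite /lrun (leq_trans ij jw) -(lastn_lastn w ij).
exact: periodic_lastn.
Qed.

Lemma ins_lastn n w : (k <= n)%N -> ins (lastn n w) = ins w.
Proof.
by move=> kn; rewrite /ins !lrun_lastn ?lastn_lastn ?cand_lastn //; lia.
Qed.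

Lemma ins_neq0 w f : ins w = Some f -> f <> [::].
Proof.
rewrite /ins; case: ifP => [/andP[mw _]|_].
  case: ifP => // _ [<-] /(congr1 size) /=.
  by rewrite size_lastn => h; lia.
by case: ifP => // _ /candP[u [x []]].
Qed.

(** In a run, z ends with p^|S|, where p consists of the last P letters, and p^|S| p^omega = p^|S|
    in S. Otherwise z ends with the candidate xf, and xf = x in S gives x f^omega = x. *)
Lemma ins_neutral w z f : ins w = Some f -> lastn (size z) w = z -> z <> [::] ->
  ((if lrun m w then P * #|S| else minn N (size w)) <= size z)%N ->
  mul1 (wval d z) (om_opt (wval d f)) = wval d z.
Proof.
rewrite /ins; case: ifP => [mw|_] + wz z0.
  case: ifP => // _ [<-] Pz; have [s zs] := wvalP d z0.
  have S0 : (0 < #|S|)%N by apply/card_gt0P; exists s.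
  have Pz' : (P <= size z)%N by rewrite (leq_trans _ Pz) // leq_pmulr.
  have wz' i : (i <= size z)%N -> lastn i z = lastn i w by move=> iz; rewrite -wz lastn_lastn.
  have pz : periodic P (lastn (P * #|S|) z).
    by rewrite wz' // -(lastn_lastn _ Pm); apply: periodic_lastn; case/andP: mw.
  have E : lastn (P * #|S|) z = flatten (nseq #|S| (lastn P w)).
    rewrite -(wz' P) // -(lastn_lastn z (leq_pmulr P S0)).
    by apply: periodic_flatten; rewrite // size_lastn (minn_idPl Pz) mulnC.
  have Pne : lastn P w <> [::].
    move=> /(congr1 size); rewrite size_lastn /=.
    by case/andP: mw => h _ h2; lia.
  have [p wp] := wvalP d Pne.
  rewrite (lastn_split (P * #|S|) z) E wval_cat -mul1A; congr mul1.
  rewrite -(prednK S0) (wval_flatten _ wp) wp.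
  by congr Some; apply: om_xpow; rewrite prednK.
case: ifP => // _ /candP[u [x [E x0 f0 xf]]] Nz.
pose t := size (x ++ f).
have tN : (t <= minn N (size w))%N by rewrite -size_lastn E size_cat leq_addl.
have [tN1 tw] : (t <= N)%N /\ (t <= size w)%N by apply/andP; rewrite -leq_min.
have E2 : lastn t z = x ++ f.
  rewrite -wz lastn_lastn; last exact: leq_trans tN Nz.
  by rewrite -(lastn_lastn w tN1) E lastn_cat_long // lastn_id.
rewrite (lastn_split t z) E2 wval_cat xf -mul1A; congr mul1.
have [sx wx] := wvalP d x0; have [sf wf] := wvalP d f0.
move: xf; rewrite wval_cat wx wf => -[xf].
by congr Some; apply: om_absorb.
Qed.

(** Pigeonhole on the N > |S| + 1 nonempty prefixes of v: of two with the same value, the shorter is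
    x and the rest of the longer is f. *)
Lemma cand_exists h v : size v = N -> (#|S|.+1 < N)%N ->
  exists2 i, (0 < i <= N)%N & cand (h ++ take i v) <> None.
Proof.
move=> sv SN; pose F (i : 'I_N) := wval d (take i.+1 v).
have /injectivePn [i [j ij Fij]] : ~~ injectiveb F.
  apply/negP => /injectiveP /leq_card.
  by rewrite card_ord card_option leqNgt SN.
wlog lt_ij : i j ij Fij / (i < j)%N => [W|].
  have := ij; rewrite -val_eqE neq_ltn => /orP[]; first exact: (W i j).
  by apply: (W j i); rewrite // eq_sym.
have jN := ltn_ord j.
exists j.+1; first by rewrite jN.
rewrite /cand; case: pselect => // -[]; exists (drop i.+1 (take j.+1 v)).
have st : size (take j.+1 v) = j.+1 by rewrite size_take_min sv; lia.
exists (lastn (N - j.+1) h), (take i.+1 v); split.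
- rewrite lastn_cat_short st //.
  by rewrite -{1}(cat_take_drop i.+1 (take j.+1 v)) take_takel //; lia.
- by move/(congr1 size); rewrite size_take_min sv /=; lia.
- by move/(congr1 size); rewrite size_drop st /=; lia.
- by rewrite -{1}(@take_takel _ i.+1 j.+1) ?cat_take_drop //; lia.
Qed.

(* If [anch w = Some f], then w with insertions has value f^omega in every
   semigroup of D, even if nothing is inserted at the end of w itself. *)
Definition anch w := if lrun m w then Some (lastn P w) else ins w.

Variable L : nat.
Hypotheses (LE : L = (N * (size J).+1)%N) (Lk : (L <= k)%N) (SN : (#|S|.+1 < N)%N).
Hypothesis PL : forall D, (0 < D <= L)%N -> (D %| P)%N.

(** A shift by D letters leaves the window unchanged, so D is a period of it. The window is full, as
    a shorter one would have grown. *)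
Lemma lastn_rot D (h z : seq A) : (0 < D <= k)%N -> size z = D -> lastn k h = lastn k (h ++ z) ->
  (k <= size h)%N /\ periodic D (lastn k h).
Proof.
move=> /andP[D0 Dk] sz E.
have kh : (k <= size h)%N.
  by have := congr1 size E; rewrite !size_lastn size_cat sz => h1; lia.
split => //; rewrite /periodic size_lastn (minn_idPl kh).
rewrite {2}E -(lastn_cat_lastn _ _ (leqnn k)) /lastn -/(lastn k h) size_cat size_lastn (minn_idPl kh) sz.
rewrite addKn drop_cat size_lastn (minn_idPl kh).
case: ltnP => [Dk'|kD]; last first.
  by rewrite drop_oversize ?size_lastn ?(minn_idPl kh) // (_ : k - D = 0)%N ?take0 //; lia.
by rewrite take_size_cat // size_drop size_lastn (minn_idPl kh).
Qed.

(** Otherwise each of the |J| + 1 blocks of length N in the last L letters has a candidate, and all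
    of these are forbidden. Two of them share a window, which by [lastn_rot] has a period dividing
    P, so that [anch] is defined there after all. *)
Lemma anch_exists w : (L <= size w)%N ->
  exists w1 w2, [/\ w = w1 ++ w2, (size w2 <= L)%N & anch w1 <> None].
Proof.
move=> Lw; apply: contrapT => noanch.
set w0 := take (size w - L) w; set v := lastn L w.
have sv : size v = L by rewrite size_lastn; lia.
have na t : anch (w0 ++ take t v) = None.
  case E : anch => [f|] //; case: noanch.
  exists (w0 ++ take t v), (drop t v); split; last by rewrite E.
    by rewrite -catA !cat_take_drop.
  by rewrite size_drop sv leq_subr.
have blk (b : 'I_(size J).+1) : exists i, (0 < i <= N)%N /\
    lastn k (w0 ++ take (b * N + i) v) \in map (lastn k) J.
  have sb : size (take N (drop (b * N) v)) = N.
    rewrite size_take_min size_drop sv LE; apply/minn_idPl.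
    rewrite mulnC -mulnBl leq_pmull // subn_gt0 ltn_ord //.
  have [i iN ci] := cand_exists (w0 ++ take (b * N) v) sb SN.
  exists i; split => //; have := na (b * N + i)%N.
  have -> : take (b * N + i) v = take (b * N) v ++ take i (take N (drop (b * N) v)).
    by rewrite takeD take_takel //; case/andP: iN.
  rewrite catA /anch /ins; case: (lrun m _) => //.
  by case: (lastn k _ \in _) => // /ci.
have [g gP] := choice blk.
pose t (b : 'I_(size J).+1) := (b * N + g b)%N.
pose F b := lastn k (w0 ++ take (t b) v).
have /injectivePn [i [j ij Fij]] : ~~ injectiveb F.
  apply/negP => /injectiveP Finj.
  have uF : uniq (map F (enum 'I_(size J).+1)) by rewrite map_inj_uniq ?enum_uniq.
  have : (size (map F (enum 'I_(size J).+1)) <= size (map (lastn k) J))%N.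
    by apply: uniq_leq_size uF _ => _ /mapP[b _ ->]; case: (gP b).
  have -> : size (map F (enum 'I_(size J).+1)) = (size J).+1.
    by rewrite size_map size_enum_ord.
  by rewrite size_map ltnn.
wlog lt_ij : i j ij Fij / (i < j)%N => [W|].
  have := ij; rewrite -val_eqE neq_ltn => /orP[]; first exact: (W i j).
  by apply: (W j i); rewrite // eq_sym.
have tL b : (t b <= L)%N.
  have [/andP[_ gN] _] := gP b.
  by rewrite LE mulnC /t (leq_trans (leq_add (leqnn _) gN)) // addnC -mulSn leq_mul2r ltn_ord orbT.
have tij : (t i < t j)%N.
  have [/andP[_ gN] _] := gP i; have [/andP[g0 _] _] := gP j.
  rewrite /t (leq_ltn_trans (leq_add (leqnn _) gN)) // addnC -mulSn.
  by rewrite -[(_ * _)%N]addn0 -addnS leq_add // leq_mul2r lt_ij orbT.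
have := Fij; rewrite /F -(subnKC (ltnW tij)) takeD catA.
set z := take _ (drop _ _) => Fz.
have sz : size z = (t j - t i)%N.
  by rewrite size_take_min size_drop sv; have := tL j; lia.
have Dk : (0 < t j - t i <= k)%N by have := tL j; lia.
have [kh pD] := lastn_rot Dk sz Fz.
have := na (t i); rewrite /anch /lrun.
have mh : (m <= size (w0 ++ take (t i) v))%N by lia.
rewrite mh -(lastn_lastn _ (ltnW mk)).
rewrite (periodic_lastn _ (periodic_dvd _ pD)) //.
by apply: PL; have := tL j; lia.
Qed.

(** * Values in semigroups of D *)

Section Definite.
Variables (R : finSemigroupType) (r : A -> R).
Hypothesis hD : D_class R.

Lemma mul1_om_opt (x : option R) w : w <> [::] -> mul1 x (om_opt (wval r w)) = om_opt (wval r w).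
Proof.
move=> /(wvalP r)[y ->]; case: x => [x|] //.
by congr Some; apply: hD; apply: om_idem.
Qed.

Lemma om_opt_rot c w :
  mul1 (om_opt (wval r (c :: w))) (Some (r c)) = om_opt (wval r (rcons w c)).
Proof.
rewrite wval_rcons /=; case: (wval r w) => [y|] /=; congr Some.
  by rewrite om_shift; apply: hD; apply: om_idem.
rewrite omE xpow_comm ?fact_gt0 // -omE.
by apply: hD; apply: om_idem.
Qed.

Lemma img_ins w f : ins w = Some f -> img ins r [::] w = om_opt (wval r f).
Proof.
move=> wf; have f0 := ins_neq0 wf.
case/lastP: w wf => [|w a wf].
  rewrite /ins; case: ifP => [/andP[/= m0 _]|_]; first by lia.
  case: ifP => // _ /candP[u [x [/(congr1 size)]]].
  by rewrite size_lastn !size_cat; case: (x) => //=; lia.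
by rewrite img_rcons /step_val wf /= mul1A mul1_om_opt.
Qed.

(** Induction along the run: the power is inserted when the run has length exactly m. Each later
    letter repeats the first letter of the preceding period, so [om_opt_rot] gives the rotated
    power. *)
Lemma anch_val w f : anch w = Some f -> img ins r [::] w = om_opt (wval r f).
Proof.
rewrite /anch; case: ifP => [mw [<-]|_ /img_ins //] {f}.
elim/last_ind: w mw => [|w a IH] mw; first by move: mw => /andP[/=]; lia.
case: (boolP (lrun m.+1 (rcons w a))) => mw1; last first.
  by apply: img_ins; rewrite /ins mw (negbTE mw1).
rewrite img_rcons /step_val /ins /= mw mw1 mul1N.
have mw' : lrun m w.
  move: mw1 => /andP[]; rewrite size_rcons ltnS /lrun => -> /=.
  rewrite -cats1 lastn_cat_short // subn1 /= => /(periodic_take (size (lastn m w))).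
  by rewrite take_size_cat.
rewrite IH //.
have Pw : (P <= size w)%N by case/andP: mw' => + _; apply: leq_trans.
have : periodic P (lastn P.+1 (rcons w a)).
  rewrite -(lastn_lastn _ (_ : P.+1 <= m.+1)%N) //.
  by apply: periodic_lastn; case/andP: mw1.
have -> : lastn P (rcons w a) = rcons (behead (lastn P w)) a.
  rewrite -!cats1 lastn_cat_short // -drop1 /lastn drop_drop /=.
  by congr (drop _ _ ++ _); lia.
rewrite -cats1 lastn_cat_short // subn1 /=.
have : size (lastn P w) = P by rewrite size_lastn; lia.
case: (lastn P w) => [|c s] /= sP; first by lia.
(* Positions 0 and P of the last P + 1 letters agree: the new letter is c. *)
move=> /periodicP/(_ a 0) /=; rewrite add0n size_cat /= addn1 sP => /(_ (leqnn _)).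
rewrite -sP /= nth_cat ltnn subnn /= => ->.
exact: om_opt_rot.
Qed.

Lemma anch_cat u v : (k <= size v)%N -> anch (u ++ v) = anch v.
Proof.
move=> kv; have E w : anch w = anch (lastn k w).
  by rewrite /anch ins_lastn // lrun_lastn ?lastn_lastn //; lia.
by rewrite E lastn_cat_long // -E.
Qed.

(** [anch] is defined at some prefix u1 of the last k + L letters. As u1 has at least k letters, it
    gives the same power whatever precedes it, and this power is the whole value up to u1. *)
Lemma img_det w1 w2 : lastn (k + L) w1 = lastn (k + L) w2 ->
  img ins r [::] w1 = img ins r [::] w2.
Proof.
move=> E; have sE := congr1 size E; rewrite !size_lastn in sE.
case: (ltnP (size w1) (k + L)) => [w1s|w1s].
  have w2s : (size w2 < k + L)%N by lia.
  by move: E; rewrite !lastn_id 1?ltnW // => ->.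
have [|u1 [u2 [uE u2L]]] := @anch_exists (lastn (k + L) w1).
  by rewrite size_lastn; lia.
have ku1 : (k <= size u1)%N.
  by have := congr1 size uE; rewrite size_lastn size_cat; lia.
case ha : (anch u1) => [f|] // _.
have H w : lastn (k + L) w = u1 ++ u2 ->
    img ins r [::] w = mul1 (om_opt (wval r f)) (img ins r u1 u2).
  move=> wE; rewrite (lastn_split (k + L) w) wE catA img_cat.
  rewrite (@anch_val _ f) ?anch_cat //; congr mul1; apply: (@img_local _ _ _ _ k) => [x|].
    by rewrite ins_lastn.
  by rewrite /= lastn_cat_long.
by rewrite !H // -E.
Qed.

End Definite.

End Insertion.

(* X e and Y e stand for the window at the source of the edge e and for a prefix
   of its label; M and K have to be chosen before them, since X depends on K. *)
Lemma insertion_rule (A : eqType) (S : finSemigroupType) (d : A -> S) (E : finType) :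
  exists M K : nat, (1 < K)%N /\ forall X Y : E -> seq A,
  exists ins : seq A -> option (seq A),
  [/\ (forall w, ins (lastn K w) = ins w),
      (forall w, img ins d [::] w = wval d w),
      (forall e y, take M y = take M (Y e) -> img ins d (X e) y = wval d y) &
      forall (R : finSemigroupType) (r : A -> R), D_class R ->
        forall w1 w2, lastn K w1 = lastn K w2 ->
        img ins r [::] w1 = img ins r [::] w2].
Proof.
(* [J] will have c N words, whence L. P is a multiple of every D <= L, M0 is at least P |S| and P,
   and k exceeds every m that may be chosen below. *)
pose n := #|S|; pose N := n.+2; pose c := #|E|; pose L := (N * (c * N).+1)%N.
pose P := (L`!)%N; pose M0 := (P * n.+1)%N; pose k := (M0 + c * M0 + 1 + N + L)%N.
exists (M0 + N)%N, (k + L)%N; split; first by rewrite /k /N; lia.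
move=> X Y.
pose hist e j := X e ++ take j (Y e).
have P0 : (0 < P)%N by apply: fact_gt0.
have Nk : (N <= k)%N by rewrite /k; lia.
have Lk : (L <= k)%N by rewrite /k; lia.
have PnM0 : (P * n <= M0)%N by rewrite leq_mul2l leqnSn orbT.
have PM0 : (P <= M0)%N by rewrite leq_pmulr.
pose exactly m (w : seq A) := lrun P m w && ~~ lrun P m.+1 w.
have exact_uniq m1 m2 w : exactly m1 w -> exactly m2 w -> m1 = m2.
  move=> /andP[l1 n1] /andP[l2 n2]; apply/eqP; rewrite eqn_leq.
  apply/andP; split; rewrite leqNgt; apply/negP => lt12.
    by case/negP: n2; apply: lrun_le lt12 l1.
  by case/negP: n1; apply: lrun_le lt12 l2.
(* A word ends in a run of exact length m for at most one m, so the c M0 histories cannot exclude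
   all c M0 + 1 values. *)
have [m [M0m mM0 mX]] : exists m, [/\ (M0 <= m)%N, (m <= M0 + c * M0)%N &
    forall e j, (0 < j <= M0)%N -> ~~ exactly m (hist e j)].
  apply: contrapT => nom.
  have bad (i : 'I_(c * M0).+1) : exists ej : E * 'I_M0, exactly (M0 + i)%N (hist ej.1 ej.2.+1).
    apply: contrapT => noej; case: nom; exists (M0 + i)%N; split.
    - exact: leq_addr.
    - by rewrite leq_add2l -ltnS.
    - move=> e [|j] // jM0; apply/negP => ex; case: noej.
      by exists (e, Ordinal jM0).
  have [g gP] := choice bad.
  have /leq_card : injective g.
    move=> i1 i2 gi; apply/val_inj/eqP; rewrite -(eqn_add2l M0); apply/eqP.
    by apply: exact_uniq (gP i1) _; rewrite gi; apply: gP.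
  by rewrite card_prod !card_ord ltnn.
(* A candidate has at most N letters, so after N letters of an edge it lies within the label and its
   power is absorbed there. *)
pose J := [seq hist e j | e <- enum E, j <- iota 1 N].
have sJ : size J = (c * N)%N by rewrite size_allpairs size_iota -cardE.
have mk : (m < k)%N by rewrite /k; lia.
have Pm : (P * #|S| <= m)%N := leq_trans PnM0 M0m.
have Pm' : (P <= m)%N := leq_trans PM0 M0m.
exists (ins d N P m k J); split.
- by move=> w; rewrite ins_lastn ?leq_addr.
- move=> w; apply: img_neutral => u w' g _ u0 ug.
  apply: (ins_neutral mk Nk P0 Pm Pm' ug) => //; first by rewrite lastn_id.
  by case: ifP => [/andP[mu _]|_]; [apply: leq_trans mu | rewrite geq_minr].
- move=> e y yY; apply: img_neutral => u w' g yE u0 ug.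
  apply: (ins_neutral mk Nk P0 Pm Pm' ug) => //.
    by rewrite lastn_cat_long // lastn_id.
  have uY : (size u <= M0 + N)%N -> X e ++ u = hist e (size u).
    move=> su; congr cat; rewrite -(take_takel (Y e) su) -yY take_takel // yE.
    by rewrite take_size_cat.
  have su0 : (0 < size u)%N by case: (u) u0.
  (* Were u too short to absorb the power, its history would be one excluded by the choice of m, or
     one in [J]. *)
  case: ifP => mu; rewrite leqNgt; apply/negP => su.
    have su1 : (size u <= M0)%N by rewrite (leq_trans (ltnW su)).
    have := mX e (size u); rewrite su0 su1 => /(_ isT); rewrite -uY /exactly ?mu /=; last by lia.
    by move: ug; rewrite /ins mu; case: ifP.
  have su1 : (size u <= N)%N by move: su; rewrite leq_min; lia.
  move: ug; rewrite /ins mu (_ : _ \in _ = true) //; apply: map_f.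
  rewrite uY; last by lia.
  by apply: allpairs_f; rewrite ?mem_enum // mem_iota su0 add1n ltnS.
- move=> R r hD w1 w2 w12; apply: (@img_det _ S d N P m k J) => //; rewrite sJ //.
  by move=> D D0; apply: dvdn_fact.
Qed.

(** * Semigroups of words and powers *)

Lemma ext1_eqN (F : Type) (S : finSemigroupType) (f : F -> S) (x y : option F) :
  one1 S = None -> ext1 f x = ext1 f y -> isSome x = isSome y.
Proof. by case: x y => [x|] [y|] //= ->. Qed.

Lemma one1_None (S : finSemigroupType) : (forall e : S, ~ is_identity e) -> one1 S = None.
Proof.
move=> noid; rewrite /one1; case: pickP => // e /forallP eid; case: (noid e) => x.
by have /andP[/eqP ? /eqP ?] := eid x.
Qed.

Lemma one1_Some (S : finSemigroupType) e : one1 S = Some e -> is_identity e.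
Proof.
rewrite /one1; case: pickP => // e' /forallP eid [<-] x.
by have /andP[/eqP ? /eqP ?] := eid x.
Qed.

(* A copy of ['I_n] in [Set]: the universes of ['I_n], of [bseq_of] and of an
   arbitrary [finType] are above that of the carriers of finite semigroups. *)
Definition idx (n : nat) : Set := {i : nat | (i < n)%N}.

HB.instance Definition _ n := [isSub of idx n for sval].
HB.instance Definition _ n := [Countable of idx n by <:].

Definition idx_ord n (i : idx n) : 'I_n := Ordinal (valP i).
Definition ord_idx n (i : 'I_n) : idx n := Sub (val i) (ltn_ord i).

Lemma idx_ordK n : cancel (@idx_ord n) (@ord_idx n).
Proof. by move=> i; apply: val_inj. Qed.

Lemma ord_idxK n : cancel (@ord_idx n) (@idx_ord n).
Proof. by move=> i; apply: val_inj. Qed.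

HB.instance Definition _ n := isFinite.Build (idx n) (pcan_enumP (can_pcan (@idx_ordK n))).

Section BoundedWords.
Variables (n M : nat).

Definition short : pred (seq (idx n)) := fun w => (size w <= M)%N.

Definition bword : Set := {w : seq (idx n) | short w}.
HB.instance Definition _ := [isSub of bword for sval].
HB.instance Definition _ := [Countable of bword by <:].

Fact bword_bseqK :
  cancel (fun x : bword => Bseq (valP x : (size (val x) <= M)%N))
         (fun x : M.-bseq (idx n) => Sub (bseqval x) (size_bseq x) : bword).
Proof. by move=> x; apply: val_inj. Qed.

HB.instance Definition _ := isFinite.Build bword (pcan_enumP (can_pcan bword_bseqK)).

Lemma size_bword (x : bword) : (size (val x) <= M)%N. Proof. exact: valP x. Qed.

End BoundedWords.

Section PrefixSemigroup.
Variables (n M : nat).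
Local Notation A := (idx n).

(** Under the truncated product below, a pseudoword evaluates here to its prefix of length M, which
    the edge condition of [insertion_rule] refers to. *)
Definition prefix_word : Set := bword n M.
HB.instance Definition _ := Finite.on prefix_word.
HB.instance Definition _ := SubType.on prefix_word.

Fact size_take_le (w : seq A) : short M (take M w).
Proof. by rewrite /short size_take_min geq_minl. Qed.

Definition prefix_of w : prefix_word := Sub (take M w) (size_take_le w).

Definition prefix_mul (x y : prefix_word) : prefix_word := prefix_of (val x ++ val y).

Lemma take_catl (u v : seq A) : take M (take M u ++ v) = take M (u ++ v).
Proof.
case: (leqP (size u) M) => uM; first by rewrite (take_oversize uM).
by rewrite !takel_cat ?take_takel ?size_take_min //; lia.
Qed.

Lemma take_catr (u v : seq A) : take M (u ++ take M v) = take M (u ++ v).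
Proof.
rewrite !take_cat; case: ltnP => // uM.
by rewrite take_takel ?leq_subr.
Qed.

Fact prefix_mulA : associative prefix_mul.
Proof. by move=> x y z; apply: val_inj; rewrite /= take_catl take_catr catA. Qed.

HB.instance Definition _ := isSemigroup.Build prefix_word prefix_mulA.

Lemma wval_prefix w x : wval (fun a => prefix_of [:: a]) w = Some x ->
  val x = take M w.
Proof.
elim: w x => //= a w IH x; case E : (wval _ w) => [y|] -[<-] /=.
  by rewrite (IH y) // take_catl take_catr.
by case: w E {IH} => [|b w] //=; case: (wval _ w).
Qed.

End PrefixSemigroup.

Section Power.
Variables (X : finType) (T : finSemigroupType).

(* [{ffun X -> T}] as a list of values, again for universe reasons. *)
Definition pow_size : pred (seq T) := fun s => size s == #|X|.

Definition pow : Type := {s : seq T | pow_size s}.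
HB.instance Definition _ := [isSub of pow for sval].
HB.instance Definition _ := [Countable of pow by <:].

Definition pow_tuple (p : pow) : #|X|.-tuple T := Tuple (valP p).
Definition tuple_pow (t : #|X|.-tuple T) : pow := Sub (tval t) (valP t).

Lemma pow_tupleK : cancel pow_tuple tuple_pow.
Proof. by move=> p; apply: val_inj. Qed.

Lemma tuple_powK : cancel tuple_pow pow_tuple.
Proof. by move=> p; apply: val_inj. Qed.

HB.instance Definition _ := isFinite.Build pow (pcan_enumP (can_pcan pow_tupleK)).

Definition app (p : pow) (x : X) : T := tnth (pow_tuple p) (enum_rank x).
Definition mkpow (f : X -> T) : pow := tuple_pow [tuple f (enum_val i) | i < #|X|].

Lemma app_mkpow f x : app (mkpow f) x = f x.
Proof. by rewrite /app tuple_powK tnth_mktuple enum_rankK. Qed.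

Lemma powP p q : (forall x, app p x = app q x) -> p = q.
Proof.
move=> pq; apply: (can_inj pow_tupleK); apply: eq_from_tnth => i.
by have := pq (enum_val i); rewrite /app enum_valK.
Qed.

Definition pow_mul (p q : pow) : pow := mkpow (fun x => app p x * app q x).

Fact pow_mulA : associative pow_mul.
Proof. by move=> p q r; apply: powP => x; rewrite !app_mkpow mulgA. Qed.

HB.instance Definition _ := isSemigroup.Build pow pow_mulA.

Lemma appM (p q : pow) x : app (p * q) x = app p x * app q x.
Proof. exact: app_mkpow. Qed.

End Power.

Section PowerClosure.
Variables (V : semigroup_class) (X : finType) (T : finSemigroupType).
Hypotheses (pvV : pseudovariety V) (VT : V T).

(** An iterated binary product separates the coordinates in s; for s listing X this embeds the power
    in a member of V. *)
Lemma pow_proj (s : seq X) : exists P : finSemigroupType, V P /\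
  exists h : {multiplicative pow X T -> P},
    forall p q, h p = h q -> {in s, forall x, app p x = app q x}.
Proof.
case: pvV => _ _ Vunit Vprod.
elim: s => [|x s [P [VP [h hP]]]].
  exists unit; split => //.
  have hM : {morph (fun _ : pow X T => tt) : p q / p * q} by [].
  by exists (HB.pack_for {multiplicative pow X T -> unit} (fun _ : pow X T => tt)
    (isMultiplicative.Build _ _ _ hM)).
exists (T * P)%type; split; first exact: Vprod.
pose h' (p : pow X T) : (T * P)%type := (app p x, h p).
have hM : {morph h' : p q / p * q} by move=> p q; congr (_, _); rewrite ?appM ?gmulfM.
exists (HB.pack_for {multiplicative pow X T -> (T * P)%type} h'
  (isMultiplicative.Build _ _ _ hM)) => p q [E1 E2] y.
rewrite inE => /predU1P[-> //|ys]; exact: hP.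
Qed.

Lemma pow_class : V (pow X T).
Proof.
have [P [VP [h hP]]] := pow_proj (enum X).
case: pvV => Vsub _ _ _; apply: (Vsub _ _ h) => // p q /hP pq.
by apply: powP => x; apply: pq; rewrite mem_enum.
Qed.

End PowerClosure.

Section DefiniteSemigroup.
Variables (n k : nat).
Local Notation A := (idx n).
Local Notation K := k.+2.
Local Notation Q := (bword n K).

Fact size_lastn_le (w : seq A) : short K (lastn K w).
Proof. by rewrite /short size_lastn geq_minl. Qed.

Definition sfx w : Q := Sub (lastn K w) (size_lastn_le w).

Lemma sfx_cat_lastn u v : sfx (lastn K u ++ v) = sfx (u ++ v).
Proof. by apply: val_inj; rewrite /= lastn_cat_lastn. Qed.

Lemma sfx_cat_lastnr u v : sfx (u ++ lastn K v) = sfx (u ++ v).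
Proof. by apply: val_inj; rewrite /= lastn_cat_lastnr. Qed.

Lemma sfx_id (q : Q) : sfx (val q) = q.
Proof. by apply: val_inj; rewrite /= lastn_id ?size_bword. Qed.

Lemma sfx_neq0 w : w <> [::] -> val (sfx w) <> [::].
Proof. by case: w => // a w _ /(congr1 size) /=; rewrite size_lastn /=; lia. Qed.

Definition nonnil : pred Q := fun q => val q != [::].

(** With the product below, the relatively free semigroup on n letters for y x_1 ... x_K = x_1 ...
    x_K. *)
Definition def_word : Set := {q : Q | nonnil q}.
HB.instance Definition _ := [isSub of def_word for sval].
HB.instance Definition _ := [Finite of def_word by <:].

Definition dw (x : def_word) : seq A := val (val x).

Lemma dw_inj : injective dw.
Proof. by move=> x y xy; do 2!apply: val_inj. Qed.

Lemma size_dw x : (0 < size (dw x) <= K)%N.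
Proof. by rewrite size_bword andbT lt0n size_eq0; exact: (valP x). Qed.

Fact def_mul_subproof (x y : def_word) : nonnil (sfx (dw x ++ dw y)).
Proof.
apply/eqP/sfx_neq0 => /(congr1 size); rewrite size_cat /=.
have := size_dw x; lia.
Qed.

Definition def_mul (x y : def_word) : def_word := Sub _ (def_mul_subproof x y).

Lemma dw_def_mul x y : dw (def_mul x y) = lastn K (dw x ++ dw y).
Proof. by []. Qed.

Fact def_mulA : associative def_mul.
Proof.
by move=> x y z; apply: dw_inj; rewrite !dw_def_mul lastn_cat_lastn // lastn_cat_lastnr catA.
Qed.

HB.instance Definition _ := isSemigroup.Build def_word def_mulA.

Lemma dwM (x y : def_word) : dw (x * y) = lastn K (dw x ++ dw y).
Proof. by []. Qed.

(** Squaring does not lengthen an idempotent, so it has full length K and erases all that precedes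
    it. *)
Lemma def_word_D : D_class def_word.
Proof.
move=> e ee s; apply: dw_inj; rewrite dwM lastn_cat_long ?lastn_id //.
  by have := size_dw e; lia.
have := congr1 (size \o dw) ee; rewrite /= dwM size_lastn size_cat.
have := size_dw e; lia.
Qed.

Fact def_letter_subproof (a : A) : nonnil (sfx [:: a]).
Proof. by apply/eqP/sfx_neq0. Qed.

Definition def_letter a : def_word := Sub _ (def_letter_subproof a).

Lemma dw_letter a : dw (def_letter a) = [:: a].
Proof. by []. Qed.

(** This uses K >= 2: e times a letter has length at least 2, so it is not that letter. *)
Lemma def_word_noid (e : def_word) : ~ is_identity e.
Proof.
move=> eid; have := size_dw e; case E : (dw e) => [|a w] // _.
have [/(congr1 (size \o dw)) + _] := eid (def_letter a).
by rewrite /= dwM size_lastn size_cat E dw_letter /=; lia.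
Qed.

Lemma wval_def w x : wval def_letter w = Some x -> dw x = lastn K w.
Proof.
elim: w x => //= a w IH x; case E : (wval _ w) => [y|] -[<-].
  by rewrite dwM (IH y) // lastn_cat_lastnr dw_letter.
by case: w E {IH} => [|b w] /=; [rewrite dw_letter lastn_id | case: (wval _ w)].
Qed.

Section Action.
Variable T : finSemigroupType.

(** The wreath product action; Q is [def_word] with the empty window as identity. *)
Definition def_act (r : def_word) (F : pow Q T) : pow Q T :=
  mkpow (fun q => app F (sfx (val q ++ dw r))).

Fact def_actMl r r' F : def_act (r * r') F = def_act r (def_act r' F).
Proof.
by apply: powP => q; rewrite !app_mkpow /= dwM sfx_cat_lastnr sfx_cat_lastn catA.
Qed.

Fact def_actMr r F F' : def_act r (F * F') = def_act r F * def_act r F'.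
Proof. by apply: powP => q; rewrite {1}/def_act app_mkpow !appM /def_act !app_mkpow. Qed.

Fact def_act_id r : is_identity r -> forall F, def_act r F = F.
Proof. by move/def_word_noid. Qed.

Definition def_action : left_action (pow Q T) def_word :=
  LeftAction def_actMl def_actMr def_act_id.

Lemma semidirect_noid (e : semidirect def_action) : ~ is_identity e.
Proof.
case: e => F r eid; apply: (@def_word_noid r) => x.
by have [/(congr1 snd) /= ? /(congr1 snd) /= ?] := eid (F, x).
Qed.

End Action.

End DefiniteSemigroup.

(** * Pseudowords over windows *)

Lemma wval_map (A B : Type) (T : semigroupType) (f : B -> T) (g : A -> B) w :
  wval f (map g w) = wval (f \o g) w.
Proof. by elim: w => //= a w ->. Qed.

Section Coding.
Variable A : finType.

Definition code (a : A) : idx #|A| := ord_idx (enum_rank a).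
Definition dec (i : idx #|A|) : A := enum_val (idx_ord i).

Lemma codeK : cancel code dec.
Proof. by move=> a; rewrite /dec ord_idxK enum_rankK. Qed.

Lemma decK : cancel dec code.
Proof. by move=> i; rewrite /code enum_valK idx_ordK. Qed.

Lemma ev_code (T : finSemigroupType) (f : A -> T) u :
  exists w, wval (f \o dec) w = Some (ev f u).
Proof.
have [w <-] := ev_word f u; exists (map code w).
by rewrite wval_map; apply: eq_wval => a /=; rewrite codeK.
Qed.

Lemma ev_code2 (S T : finSemigroupType) (f : A -> S) (g : A -> T) u :
  exists w, wval (f \o dec) w = Some (ev f u) /\ wval (g \o dec) w = Some (ev g u).
Proof.
have [w] := ev_code (fun a => (f a, g a)) u; rewrite ev_pair => /(wval_pair (f := f \o dec)).
by exists w.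
Qed.

Lemma ev_code3 (S T U : finSemigroupType) (f : A -> S) (g : A -> T) (h : A -> U) u :
  exists w, [/\ wval (f \o dec) w = Some (ev f u), wval (g \o dec) w = Some (ev g u)
    & wval (h \o dec) w = Some (ev h u)].
Proof.
have [w] := ev_code2 (fun a => (f a, g a)) h u; rewrite ev_pair.
by move=> [/(wval_pair (f := f \o dec))[fw gw] hw]; exists w.
Qed.

End Coding.

Section Windows.
Variables (A : finType) (k : nat).
Local Notation n := #|A|.
Local Notation K := k.+2.
Local Notation Q := (bword n K).
Local Notation B := (Q * idx n)%type.

(** The path labelled w from q in the graph of windows, whose edges (q, a) lead from q to the window
    at the end of qa. *)
Fixpoint pathw (q : Q) (w : seq (idx n)) : seq B :=
  if w is a :: w' then (q, a) :: pathw (sfx k (rcons (val q) a)) w' else [::].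

Lemma sfx_sfx_rcons (q : Q) a w :
  sfx k (val (sfx k (rcons (val q) a)) ++ w) = sfx k (val q ++ a :: w).
Proof. by rewrite /= sfx_cat_lastn cat_rcons. Qed.

Section Lift.
Variables (T : finSemigroupType) (g : B -> T).

(** Chosen so that the first component of the value of w maps q to the value of g on [pathw q w]. *)
Definition lift (a : A) : semidirect (def_action n k T) :=
  (mkpow (fun q : Q => g (q, code a)), def_letter k (code a)).

Lemma wval_lift w (x : semidirect (def_action n k T)) : wval (lift \o @dec A) w = Some x ->
  dw x.2 = lastn K w /\ forall q, Some (app x.1 q) = wval g (pathw q w).
Proof.
elim: w x => //= a w IH x.
case E : (wval _ w) => [y|] -[<-]; last first.
  case: w E {IH} => [|b w] /=; last by case: (wval _ w).
  by split=> [|q]; rewrite ?app_mkpow /= decK ?lastn_id.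
have [y2 y1] := IH _ E; split => [|q].
  by rewrite /= dwM y2 dw_letter lastn_cat_lastnr decK.
by rewrite /= -y1 appM !app_mkpow /= decK dw_letter cats1.
Qed.

End Lift.

Definition endq (u : pseudoword A) : Q := val (ev (fun a => def_letter k (code a)) u).

Lemma ev_lift (T : finSemigroupType) (g : B -> T) u :
  (ev (lift g) u).2 = ev (fun a => def_letter k (code a)) u.
Proof.
have [w [/wval_lift[w2 _] wd]] := ev_code2 (lift g) (fun a => def_letter k (code a)) u.
apply: dw_inj; rewrite w2; apply/esym/wval_def; rewrite -wd.
by apply: eq_wval => i /=; rewrite decK.
Qed.

Fact Phi_nat q u (S T : finSemigroupType) (h : {multiplicative S -> T}) (f : B -> S) (g : B -> T) :
  (forall b, h (f b) = g b) -> h (app (ev (lift f) u).1 q) = app (ev (lift g) u).1 q.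
Proof.
move=> hf; have [w [/wval_lift[_ /(_ q) wf] /wval_lift[_ /(_ q) wg]]] := ev_code2 (lift f) (lift g) u.
apply: Some_inj; rewrite wg -(eq_wval hf) -omap_wval -wf //.
Qed.

(** Extends [pathw q] to pseudowords by means of [lift], whose component at q is natural in T. *)
Definition Phi (q : Q) (u : pseudoword A) : pseudoword B :=
  pw_of (fun S T h f g => @Phi_nat q u S T h f g).

Lemma ev_Phi (T : finSemigroupType) (g : B -> T) q u : ev g (Phi q u) = app (ev (lift g) u).1 q.
Proof. exact: ev_pw_of. Qed.

Lemma PhiM q u v : Phi q (u * v) = Phi q u * Phi (sfx k (val q ++ val (endq u))) v.
Proof.
apply: pw_ext => S; rewrite -!ev_gen evM !ev_Phi evM /=.
by rewrite [LHS]appM app_mkpow ev_lift.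
Qed.

Lemma endqM u v : endq (u * v) = sfx k (val (endq u) ++ val (endq v)).
Proof. by rewrite /endq evM; apply: val_inj. Qed.

Section PathSemigroup.
Variable S : finSemigroupType.

(** A Brandt-type semigroup with zero [None]. A nonempty word over B has nonzero value under
    [path_letter] exactly when it is a path; the value then records its ends and its value under
    c. *)
Definition paths : Type := option (Q * Q * S)%type.
HB.instance Definition _ := Finite.on paths.

Definition paths_mul (x y : paths) : paths :=
  match x, y with
  | Some (q, q', s), Some (p, p', t) => if q' == p then Some (q, p', s * t) else None
  | _, _ => None
  end.

Fact paths_mulA : associative paths_mul.
Proof.
move=> [[[q q'] s]|] [[[p p'] t]|] [[[r r'] u]|] //=.
- by case E1: (p' == r); case E2: (q' == p); rewrite /= ?E1 ?E2 ?mulgA.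
- by case: eqP.
Qed.

HB.instance Definition _ := isSemigroup.Build paths paths_mulA.

Variable c : B -> S.

Definition path_letter (b : B) : paths := Some (b.1, sfx k (rcons (val b.1) b.2), c b).

Lemma wval_path_letter q w : w <> [::] -> exists2 s,
  wval path_letter (pathw q w) = Some (Some (q, sfx k (val q ++ w), s) : paths) &
  wval c (pathw q w) = Some s.
Proof.
elim: w q => // a w IH q _; case: w IH => [|b w] IH.
  by exists (c (q, a)); rewrite //= cats1.
have [//|s ws cs] := IH (sfx k (rcons (val q) a)).
exists (c (q, a) * s); last by move: cs => /= ->.
have -> : wval path_letter (pathw q [:: a, b & w]) = mul1 (Some (path_letter (q, a)))
    (wval path_letter (pathw (sfx k (rcons (val q) a)) (b :: w))) by [].
rewrite ws sfx_sfx_rcons.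
by congr Some; rewrite /mul /= eqxx.
Qed.

Lemma path_letter_word beta q q' s :
  wval path_letter beta = Some (Some (q, q', s) : paths) ->
  exists2 w, beta = pathw q w & w <> [::].
Proof.
elim: beta q q' s => //= -[p a] beta IH q q' s.
case E : (wval _ beta) => [y|] -[]; last first.
  move=> <- _ _; exists [:: a] => //; case: (beta) E => //= b l; by case: (wval _ l).
case: y E => [[[r r'] t]|] E; last by rewrite /mul.
rewrite /mul /=; case: eqP => //= rE [<- _ _].
have [w -> _] := IH _ _ _ E; exists (a :: w) => //=.
by rewrite rE.
Qed.

End PathSemigroup.

End Windows.

(** * Substituting letters and omega-powers for edges of paths *)

Section Theta.
Variables (A : finType) (k : nat).
Local Notation n := #|A|.
Local Notation K := k.+2.
Local Notation Q := (bword n K).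
Local Notation B := (Q * idx n)%type.
Variable ins : seq (idx n) -> option (seq (idx n)).
Hypothesis ins_loc : forall w, ins (lastn K w) = ins w.

Definition word_pw (w : seq (idx n)) : option (pseudoword A) :=
  wval (fun i => letter (dec i)) w.

Definition theta (b : B) : pseudoword A :=
  if obind word_pw (ins (rcons (val b.1) b.2)) is Some u
  then letter (dec b.2) * (pw_om1 u * u) else letter (dec b.2).

Lemma kappa_word_pw w u : word_pw w = Some u -> kappa_word u.
Proof.
rewrite /word_pw; elim: w u => //= i w IH u; case E : (wval _ w) => [v|] -[<-].
  by apply: kappa_mul; [apply: kappa_letter | apply: IH].
exact: kappa_letter.
Qed.

Lemma kappa_theta b : kappa_word (theta b).
Proof.
rewrite /theta; case: ins => [w|] /=; last exact: kappa_letter.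
case E : (word_pw w) => [u|]; last exact: kappa_letter.
have ku := kappa_word_pw E.
by apply: kappa_mul; [apply: kappa_letter | apply: kappa_mul => //; apply: kappa_om1].
Qed.

Section Value.
Variables (T : finSemigroupType) (f : A -> T).

Lemma ev_theta b :
  Some (ev f (theta b)) = step_val ins (f \o @dec A) (rcons (val b.1) b.2) b.2.
Proof.
rewrite /theta /step_val; case: ins => [w|] //=.
have <- : omap (ev f) (word_pw w) = wval (f \o @dec A) w by rewrite /word_pw omap_wval.
by case: (word_pw w) => [u|] //=; rewrite !evM ev_om1.
Qed.

Lemma wval_theta q w :
  wval (fun b : B => ev f (theta b)) (pathw q w) = img ins (f \o @dec A) (val q) w.
Proof.
elim: w q => //= a w IH q; rewrite ev_theta IH; congr mul1.
by apply: img_local ins_loc _; rewrite /= lastn_lastn.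
Qed.

End Value.

Section SemidirectValue.
Variables (T R : finSemigroupType) (a : left_action T R).
Hypothesis (hD : forall (r : idx n -> R) w1 w2, lastn K w1 = lastn K w2 ->
  img ins r [::] w1 = img ins r [::] w2).
Variable f : A -> semidirect a.

Definition sd_snd (x : semidirect a) : R := x.2.
Fact sd_sndM : {morph sd_snd : x y / x * y}. Proof. by []. Qed.
HB.instance Definition _ := isMultiplicative.Build _ _ sd_snd sd_sndM.

(** By [hD], the R-component of every word with window q, insertions included. *)
Definition tail_val (q : Q) : option R := img ins (sd_snd \o (f \o @dec A)) [::] (val q).

Definition oact (o : option R) (t : T) : T := if o is Some r then a r t else t.

Lemma oact_mul1 o r t : oact (mul1 o (Some r)) t = oact o (a r t).
Proof. by case: o => //= r'; rewrite actMl. Qed.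

Lemma oactM o t t' : oact o (t * t') = oact o t * oact o t'.
Proof. by case: o => //= r'; rewrite actMr. Qed.

(** In T * R, each factor contributes its T-component acted on by the R-component of what precedes.
    Along a path from the empty window the latter depends only on the current window, so the letter
    (q, a) determines its own contribution. *)
Definition twist (b : B) : T := oact (tail_val b.1) (ev f (theta b)).1.

Lemma tail_val_rcons q i :
  tail_val (sfx k (rcons (val q) i)) = mul1 (tail_val q) (Some (ev f (theta (q, i))).2).
Proof.
rewrite /tail_val (@hD _ _ (rcons (val q) i)) ?lastn_lastn // img_rcons; congr mul1.
rewrite -[(ev f _).2]/(sd_snd (ev f _)).
rewrite (@ev_nat _ _ _ sd_snd f (sd_snd \o f)) //.
by rewrite ev_theta.
Qed.

Lemma twist_path q w (x : semidirect a) : w <> [::] ->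
  wval (fun b : B => ev f (theta b)) (pathw q w) = Some x ->
  wval twist (pathw q w) = Some (oact (tail_val q) x.1) /\
  mul1 (tail_val q) (Some x.2) = tail_val (sfx k (val q ++ w)).
Proof.
elim: w q x => // i w IH q x _ /=.
case: w IH => [|j w] IH.
  move=> [<-] /=; split => //; by rewrite cats1 tail_val_rcons.
set q' := sfx k (rcons (val q) i).
case E : (wval _ (pathw q' (j :: w))) => [y|]; last by move: E => /=; case: (wval _ _).
have [//|E1 E2] := IH q' y _ E.
rewrite E1 => -[<-]; rewrite /= oactM -oact_mul1 -tail_val_rcons; split => //.
have -> : Some ((ev f (theta (q, i))).2 * y.2) = mul1 (Some (ev f (theta (q, i))).2) (Some y.2) by [].
by rewrite mul1A -tail_val_rcons -/q' E2 /q' sfx_sfx_rcons.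
Qed.

(** X is replaced by a word with the same values in the three semigroups involved. Its value in
    [paths] is nonzero, so it is a path and [twist_path] applies. *)
Lemma ev_subst_theta (S : finSemigroupType) (c : B -> S) (X : pseudoword B) q q' s :
  ev (path_letter c) X = Some (q, q', s) :> paths _ _ _ ->
  let x := ev f (subst theta X) in
  ev twist X = oact (tail_val q) x.1 /\ mul1 (tail_val q) (Some x.2) = tail_val q'.
Proof.
move=> Xp /=; rewrite ev_subst.
have [w [pw tw xw]] : exists w, [/\ wval (path_letter c) w = Some (ev (path_letter c) X),
    wval twist w = Some (ev twist X) &
    wval (fun b : B => ev f (theta b)) w = Some (ev (fun b : B => ev f (theta b)) X)].
  have [w []] := ev_word2 (fun b => (path_letter c b, twist b)) (fun b : B => ev f (theta b)) X.
  by rewrite ev_pair => /wval_pair [] ? ? ?; exists w.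
move: pw; rewrite Xp => wp; have [v wE v0] := path_letter_word wp.
move: wp; rewrite wE; have [s' -> _] := wval_path_letter c q v0.
move=> [<- _]; move: tw xw; rewrite wE => tw xw.
have [tw' <-] := twist_path v0 xw.
by split => //; apply: Some_inj; rewrite -tw -tw'.
Qed.

End SemidirectValue.

End Theta.

(** * Solutions over [V * D] *)

Lemma pseudovariety_identity (A : finType) (u v : pseudoword A) :
  pseudovariety (fun U => forall f : A -> U, ev f u = ev f v).
Proof.
split.
- move=> S T h hinj hT f; apply: hinj.
  by rewrite !(@ev_nat _ _ _ h f (h \o f)).
- move=> S T h hsurj hS f; have [g gP] := choice (fun a => hsurj (f a)).
  by rewrite -!(@ev_nat _ _ _ h g f) // hS.
- by move=> f; case: (ev f u); case: (ev f v).
- move=> S T hS hT f.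
  have E x : ev f x = (ev (fst \o f) x, ev (snd \o f) x).
    by rewrite -ev_pair; apply: eq_ev => a; apply: surjective_pairing.
  by rewrite !E hS hT.
Qed.

Lemma semidirect_classI (V W : semigroup_class) (T R : finSemigroupType) (a : left_action T R) :
  V T -> W R -> semidirect_class V W (semidirect a).
Proof. by move=> VT WR U _; apply. Qed.

Lemma semidirect_class_satisfies (V W : semigroup_class) (A : finType) (u v : pseudoword A) :
  (forall (T R : finSemigroupType) (a : left_action T R) (f : A -> semidirect a),
     V T -> W R -> ev f u = ev f v) ->
  satisfies (semidirect_class V W) (Some u) (Some v).
Proof.
move=> uv; apply/satisfiesP => U UVW f; congr Some.
apply: (UVW _ (pseudovariety_identity u v)) => T R a VT WR g.
exact: uv.
Qed.

(** V * D contains a semigroup without identity, built on windows, where no pseudoword takes the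
    value of 1. *)
Lemma semidirect_D_Some (V : semigroup_class) (A : finType) (u : pseudoword A) z : pseudovariety V ->
  satisfies (semidirect_class V D_class) (Some u) z -> exists v, z = Some v.
Proof.
case: z => [v|]; first by exists v.
move=> pvV /satisfiesP uz; have [_ _ Vunit _] := pvV.
pose f (a : A) : semidirect (def_action #|A| 0 unit) :=
  (mkpow (fun _ => tt), def_letter 0 (code a)).
have Vp : V (pow (bword #|A| 2) unit) by apply: pow_class pvV Vunit.
have := uz _ (semidirect_classI (def_action #|A| 0 unit) Vp (@def_word_D _ _)) f.
by rewrite /= one1_None //; apply: semidirect_noid.
Qed.

Lemma ev_path_letter (A : finType) (k : nat) (S : finSemigroupType)
    (c : bword #|A| k.+2 * idx #|A| -> S) X q q' s :
  ev (path_letter c) X = Some (q, q', s) :> paths _ _ _ -> ev c X = s.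
Proof.
have [w [pw cw]] := ev_word2 (path_letter c) c X.
move=> Xp; move: pw; rewrite Xp => wp; have [v wE v0] := path_letter_word wp.
move: wp cw; rewrite wE; have [s' -> cs] := wval_path_letter c q v0.
by rewrite cs => -[_ <-] [].
Qed.

Definition prefix_letter (A : finType) (M : nat) (a : A) : prefix_word #|A| M :=
  prefix_of M [:: code a].

Section PathValue.
Variables (A : finType) (k : nat) (S : finSemigroupType) (d : A -> S).
Local Notation K := k.+2.
Variable ins : seq (idx #|A|) -> option (seq (idx #|A|)).
Hypothesis ins_loc : forall w, ins (lastn K w) = ins w.

(** A word with the prefix of u and the values of u in S and under [lift] labels the path; by
    hypothesis the insertions preserve its value in S. *)
Lemma ev_path_Phi M (q : bword #|A| K) u :
  (forall w, take M w = val (ev (@prefix_letter A M) u) ->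
     img ins (d \o @dec A) (val q) w = wval (d \o @dec A) w) ->
  ev (path_letter (fun b => ev d (theta ins b))) (Phi q u) =
    Some (q, sfx k (val q ++ val (endq k u)), ev d u) :> paths _ _ _.
Proof.
move=> H; set c := fun b => _.
have [w [lw dval pw]] := ev_code3 (lift (path_letter c)) d (@prefix_letter A M) u.
have {pw} pw : take M w = val (ev (@prefix_letter A M) u).
  apply/esym/wval_prefix; rewrite -pw; apply: eq_wval => i.
  by rewrite /= /prefix_letter decK.
have [w2 /(_ q) w1] := wval_lift lw.
have w0 : w <> [::] by apply: wval_neq0 dval.
apply: Some_inj; rewrite ev_Phi w1.
have [s -> cs] := wval_path_letter c q w0.
congr (Some (Some (_, _, _))).
  by rewrite /endq -(ev_lift (path_letter c)) -/(dw _) w2 sfx_cat_lastnr.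
by apply: Some_inj; rewrite -cs wval_theta // H.
Qed.

End PathValue.

Section Lifting.
Variables (V : semigroup_class).
Hypotheses (pvV : pseudovariety V) (kV : kappa_reducible V).
Variables (G : multigraph) (A : finType) (S : genSemigroup A).
Variables (phi : vertex G + edge G -> option S) (delta : {multiplicative pseudoword A -> S}).
Hypotheses (A0 : (0 < #|A|)%N) (dc : continuous_hom delta).
Hypothesis dl : forall x : A, delta (letter x) = gen S x.

Local Notation VD := (semidirect_class V D_class).

Lemma delta_ev u : delta u = ev (gen S) u.
Proof. by rewrite (continuous_homE u dc); apply: eq_ev => a; apply: dl. Qed.

Lemma kappa_solution_exists eta :
  (forall e, exists y, eta (inr e) = Some y) -> solution VD phi delta eta ->
  exists eta', kappa_solution VD phi delta eta'.
Proof.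
move=> /choice[y etaE] [etaphi etaeq].
pose d := gen S.
have [M [K [K1 rule]]] := insertion_rule (d \o @dec A) (edge G).
case: K K1 rule => [|[|k]] // _ rule.
pose Q := bword #|A| k.+2; pose q0 : Q := sfx k [::].
pose qv v : Q := if eta (inl v) is Some x then endq k x else q0.
have [ins [ins_loc neut0 neutE detD]] :=
  rule (fun e => val (qv (source e))) (fun e => val (ev (@prefix_letter A M) (y e))).
have vq0 : val q0 = [::] by rewrite /= lastn_id.
have q0cat (q : Q) : sfx k (val q0 ++ val q) = q by rewrite vq0 sfx_id.
pose c (b : (Q * idx #|A|)%type) : S := ev d (theta ins b).
(* Prescribing values here keeps the ends of paths and, after substitution, the value in S. *)
pose S' : genSemigroup (Q * idx #|A|)%type := gen_semigroup (path_letter c).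
pose eta1 (z : vertex G + edge G) := match z with
  | inl v => omap (Phi q0) (eta (inl v))
  | inr e => Some (Phi (qv (source e)) (y e)) end.
have pv v x : eta (inl v) = Some x ->
    ev (path_letter c) (Phi q0 x) = Some (q0, qv v, ev d x) :> paths _ _ _.
  move=> vx; rewrite (@ev_path_Phi _ _ _ d ins ins_loc M).
    by rewrite q0cat /qv vx.
  by move=> w _; rewrite vq0 neut0.
have pe e : ev (path_letter c) (Phi (qv (source e)) (y e)) =
    Some (qv (source e), sfx k (val (qv (source e)) ++ val (endq k (y e))), ev d (y e)) :> paths _ _ _.
  apply: (@ev_path_Phi _ _ _ d ins ins_loc M) => w wM; apply: neutE.
  rewrite wM take_oversize //; exact: size_bword.
have powV (T : finSemigroupType) : V T -> VD (semidirect (def_action #|A| k T)).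
  by move=> VT; apply: semidirect_classI; [apply: pow_class | apply: def_word_D].
have etaS e : exists z, eta (inl (target e)) = Some z.
  have := etaeq e; rewrite etaE.
  by case: (eta (inl (source e))) => [x|]; apply: semidirect_D_Some.
(* The first component will give the equation over V, the second the equality of end windows. *)
have eqL (T : finSemigroupType) (g : (Q * idx #|A|)%type -> T) e z : V T ->
    eta (inl (target e)) = Some z ->
    (if eta (inl (source e)) is Some x then ev (lift g) (x * y e) else ev (lift g) (y e))
    = ev (lift g) z.
  move=> VT tz; have := etaeq e; rewrite tz etaE => /satisfiesP/(_ _ (powV T VT) (lift g)).
  by case: (eta (inl (source e))) => [x|] -[].
have eqQ e : sfx k (val (qv (source e)) ++ val (endq k (y e))) = qv (target e).
  have [z tz] := etaS e; have [_ _ Vunit _] := pvV.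
  have := eqL _ (fun _ => tt) e z Vunit tz; rewrite /qv tz.
  case: (eta (inl (source e))) => [x|] /(congr1 snd).
    by rewrite -endqM !ev_lift /endq => ->.
  by rewrite q0cat !ev_lift /endq => ->.
pose delta1 : {multiplicative pseudoword (Q * idx #|A|)%type -> S'} := ev (gen S').
have [|e||||eta2 [[eta2phi eta2eq] eta2k]] := @kV G (Q * idx #|A|)%type S'
    (fun z => ext1 delta1 (eta1 z)) delta1.
- have [a _] := card_gt0P A0.
  by apply/card_gt0P; exists (q0, code a).
- by exists (delta1 (Phi (qv (source e)) (y e))).
- exact: ev_continuous.
- by [].
- exists eta1; split=> // e; apply/satisfiesP => T VT g.
  have [z tz] := etaS e; have := eqL T g e z VT tz; rewrite /= tz /= /qv.
  case: (eta (inl (source e))) => [x|] E; congr Some; last by rewrite !ev_Phi E.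
  rewrite [RHS]ev_Phi -E -ev_Phi PhiM; congr (ev g (_ * Phi _ _)).
  by rewrite q0cat.
(* An identity would come from a nonempty path ending at the empty window. Hence the new solution is
   1 exactly where [eta1] is. *)
have noid : one1 S' = None.
  apply: one1_None => e eid; have [a _] := card_gt0P A0.
  have [eg _] := eid (gen S' (q0, code a)).
  have : gen_val e * path_letter c (q0, code a) = path_letter c (q0, code a) :=
    congr1 (@gen_val _ _ (path_letter c)) eg.
  have /asboolP[w] : in_gen (path_letter c) (gen_val e) := valP e.
  move: (gen_val e) => [[[q q'] s]|] wE //; rewrite /mul /=.
  case: eqP => // q'E _.
  have [v wv v0] := path_letter_word wE.
  move: wE; rewrite wv; have [s' -> _] := wval_path_letter c q v0 => -[q''E _].
  have : val (sfx k (val q ++ v)) <> [::].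
    by apply: sfx_neq0; case: (val q) => //; exact: v0.
  by rewrite q''E q'E vq0.
pose eta3 z := omap (subst (theta ins)) (eta2 z).
have same z : isSome (eta2 z) = isSome (eta1 z) := ext1_eqN noid (eta2phi z).
have path2 z X X' : eta1 z = Some X -> eta2 z = Some X' ->
    ev (path_letter c) X' = ev (path_letter c) X.
  move=> zX zX'; have := eta2phi z; rewrite zX zX' => -[].
  move=> E; have {}E : pw_fun X' S' = pw_fun X S' by rewrite -!ev_gen.
  exact: (congr1 (fun t : gen_sub (path_letter c) => gen_val t) E).
have val2 z X q q' s : eta1 z = Some X ->
    ev (path_letter c) X = Some (q, q', s) :> paths _ _ _ ->
    exists2 X', eta2 z = Some X' & ev (path_letter c) X' = Some (q, q', s) :> paths _ _ _.
  move=> zX Xp; have := same z; rewrite zX; case E : (eta2 z) => [X'|] // _.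
  by exists X'; rewrite // (path2 z X X').
have val3 z X q q' s : eta1 z = Some X ->
    ev (path_letter c) X = Some (q, q', s) :> paths _ _ _ ->
    exists2 X', eta3 z = Some X' & delta X' = s.
  move=> zX /(val2 z X q q' s zX)[X' zX' Xp]; exists (subst (theta ins) X').
    by rewrite /eta3 zX'.
  by rewrite delta_ev ev_subst; apply: ev_path_letter Xp.
exists eta3; split; last first.
  move=> z u; rewrite /eta3; case E : (eta2 z) => [X|] // -[<-].
  by apply: kappa_subst (eta2k _ _ E); apply: kappa_theta.
split=> [z|e].
  rewrite -etaphi; case: z => [v|e].
    case E : (eta (inl v)) => [x|].
      have [|X' -> /= ->] := val3 (inl v) _ _ _ _ _ (pv v x E); first by rewrite /= E.
      by rewrite delta_ev.
    by have := same (inl v); rewrite /eta3 /= E; case: (eta2 (inl v)).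
  have [//|X' -> /= ->] := val3 (inr e) _ _ _ _ _ (pe e).
  by rewrite etaE /= delta_ev.
have [z tz] := etaS e.
have [|Z tZ pZ] := val2 (inl (target e)) _ _ _ _ _ (pv _ _ tz); first by rewrite /= tz.
have [//|Y eY pY] := val2 (inr e) _ _ _ _ _ (pe e).
(* In T * R, the T-components agree by the equation over V evaluated at [twist], the R-components
   because both sides end at the same window. *)
have := eta2eq e; rewrite /eta3 tZ eY eqQ in pY *.
case sx : (eta (inl (source e))) => [x|].
  have [|X sX pX] := val2 (inl (source e)) _ _ _ _ _ (pv _ _ sx); first by rewrite /= sx.
  rewrite sX /= => /satisfiesP eqV.
  apply: semidirect_class_satisfies => T R a f VT DR.
  have hD (r : idx #|A| -> R) := detD R r DR.
  have [Z1 Z2] := @ev_subst_theta A k ins T R a hD f _ _ _ _ _ _ pZ.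
  have [Y1 Y2] := @ev_subst_theta A k ins T R a hD f _ _ _ _ _ _ pY.
  have [X1 X2] := @ev_subst_theta A k ins T R a hD f _ _ _ _ _ _ pX.
  have tv0 : tail_val ins f q0 = None by rewrite /tail_val vq0.
  have := eqV T VT (twist ins f) => -[].
  rewrite evM X1 Y1 Z1 -X2 tv0 /= => e1.
  move: Y2 Z2; rewrite -X2 tv0 /= => <- -[e2].
  by rewrite evM [RHS]surjective_pairing -e1 e2.
have sX : eta2 (inl (source e)) = None.
  by have := same (inl (source e)); rewrite /= sx; case: (eta2 _).
have qs : qv (source e) = q0 by rewrite /qv sx.
rewrite sX /= => /satisfiesP eqV.
apply: semidirect_class_satisfies => T R a f VT DR.
have hD (r : idx #|A| -> R) := detD R r DR.
have [Z1 Z2] := @ev_subst_theta A k ins T R a hD f _ _ _ _ _ _ pZ.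
have [Y1 Y2] := @ev_subst_theta A k ins T R a hD f _ _ _ _ _ _ pY.
have tv0 : tail_val ins f q0 = None by rewrite /tail_val vq0.
have := eqV T VT (twist ins f) => -[].
rewrite Y1 Z1 qs tv0 /= => e1.
move: Y2 Z2; rewrite qs tv0 /= => <- -[e2].
by rewrite [LHS]surjective_pairing [RHS]surjective_pairing e1 e2.
Qed.

End Lifting.

(** * Replacing 1 by pseudowords when S has an identity *)

Lemma gen_letters (A : finType) (S : genSemigroup A) (s : S) :
  exists u : pseudoword A, ev (gen S) u = s.
Proof.
have : s \in finset (in_gen (gen S)).
  apply: gs_generated => [a|x y]; rewrite !inE /in_gen.
    by exists [:: a].
  move=> [v vx] [w wy]; exists (v ++ w).
  by rewrite wval_cat vx wy.
rewrite !inE => -[[|a w]] //= wE; exists (letters a w).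
apply: Some_inj; rewrite -wE -(wval_letters (ev (gen S))).
by apply: eq_wval.
Qed.

(** The values lie in eTe, where e is the identity. *)
Lemma ev_sandwich (A : finType) (T : finSemigroupType) (f : A -> T) (e : T) u :
  e * e = e -> let x := ev (fun a => e * f a * e) u in e * x = x /\ x * e = x.
Proof.
move=> ee /=; have [w] := ev_word (fun a => e * f a * e) u.
elim: w (ev _ u) => //= a w IH x; case: (wval _ w) IH => [y|] IH -[<-].
  have [e1 e2] := IH y erefl.
  by rewrite !mulgA ee -!mulgA e2.
by rewrite !mulgA ee -!mulgA ee.
Qed.

Section MonoidCase.
Variables (V : semigroup_class).
Hypothesis (pvV : pseudovariety V).
Variables (G : multigraph) (A : finType) (S : genSemigroup A).
Variables (phi : vertex G + edge G -> option S) (delta : {multiplicative pseudoword A -> S}).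
Hypothesis dc : continuous_hom delta.
Hypothesis dl : forall x : A, delta (letter x) = gen S x.

Local Notation VD := (semidirect_class V D_class).

(* If i is the identity of S and J is an omega-power with value i, replace each
   letter a by J a J and 1 by J. *)
Lemma solution_Some eta i : one1 S = Some i -> solution VD phi delta eta ->
  exists eta', solution VD phi delta eta' /\ forall z, exists u, eta' z = Some u.
Proof.
move=> S1 [etaphi etaeq]; have iid := one1_Some S1.
have [I Ii] := gen_letters i.
pose J := pw_om1 I * I.
have evJ (T : finSemigroupType) (f : A -> T) : ev f J = om (ev f I) by rewrite evM ev_om1.
have evJJ (T : finSemigroupType) (f : A -> T) : ev f J * ev f J = ev f J.
  by rewrite evJ om_idem.
have dJ : ev (gen S) J = i.
  by rewrite evJ Ii -[RHS](om_absorb (iid i).1) (iid (om i)).1.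
pose sg (a : A) := J * letter a * J.
have evsg (T : finSemigroupType) (f : A -> T) u :
    ev f (subst sg u) = ev (fun a => ev f J * f a * ev f J) u.
  by rewrite ev_subst; apply: eq_ev => a; rewrite !evM.
exists (fun z => Some (if eta z is Some u then subst sg u else J)); split; last first.
  by move=> z; eexists.
split=> [z|e].
  rewrite -etaphi; case: (eta z) => [u|] /=; last first.
    by rewrite (delta_ev dc dl) dJ S1.
  rewrite !(delta_ev dc dl) evsg dJ; congr Some; apply: eq_ev => a.
  by rewrite (iid _).1 (iid _).2.
(* The original equation is evaluated at the elements J a J, whose products absorb the factors J
   standing for 1. *)
apply/satisfiesP => T VT f; congr Some; rewrite evM.
have := etaeq e.
case: (eta (inl (source e))) => [x|]; case: (eta (inr e)) => [y|] xyz.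
- have [z zE] := semidirect_D_Some pvV xyz; rewrite zE in xyz *.
  rewrite !evsg -evM; apply: Some_inj.
  by move/satisfiesP: xyz; apply.
- have [z zE] := semidirect_D_Some pvV xyz; rewrite zE in xyz *.
  rewrite !evsg (ev_sandwich f x (evJJ _ f)).2; apply: Some_inj.
  by move/satisfiesP: xyz; apply.
- have [z zE] := semidirect_D_Some pvV xyz; rewrite zE in xyz *.
  rewrite !evsg (ev_sandwich f y (evJJ _ f)).1; apply: Some_inj.
  by move/satisfiesP: xyz; apply.
case E : (eta (inl (target e))) => [z|]; last by rewrite evJJ.
rewrite E in xyz.
have /(semidirect_D_Some pvV)[//] : satisfies VD (Some z) None.
by move=> U VU psi psic; rewrite [RHS]xyz.
Qed.

End MonoidCase.

Theorem theorem3p7 (V : semigroup_class) :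
  pseudovariety V -> ~ locally_trivial V -> kappa_reducible V ->
  kappa_reducible (semidirect_class V D_class).
Proof.
move=> pvV _ kV G A S phi delta A0 phie dc dl [eta sol].
(* An edge can have the solution 1 only if S has an identity. *)
case S1 : (one1 S) => [i|].
  have [eta' [sol' eta'S]] := solution_Some pvV dc dl S1 sol.
  exact: (kappa_solution_exists pvV kV A0 dc dl _ sol').
apply: (kappa_solution_exists pvV kV A0 dc dl _ sol) => e.
have [s phis] := phie e; have [/(_ (inr e)) + _] := sol.
rewrite phis; case: (eta (inr e)) => [y|]; first by exists y.
by rewrite /= S1.
Qed.
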